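(* Let $G$ be a finitely generated group. The following are equivalent: (1) $G$ is not virtually cyclic; (2) $G$ acts expansively on some infinite-dimensional compact metrizable space; (3) there is an infinite-dimensional $\frac{G\text{-subshift}}{\text{SFT}}$ system; (4) there is a $\frac{G\text{-SFT}}{\text{SFT}}$ system whose underlying space contains a homeomorphic copy of every compact metrizable space.
   Context: Dimension means topological (Lebesgue covering) dimension. A group is virtually cyclic if it has a cyclic subgroup of finite index (finite groups included). A dynamical $G$-system is an action of $G$ (discrete) by homeomorphisms on a compact metrizable space; it is expansive if for some compatible metric $d$ and some $\epsilon>0$, for all distinct $x,y$ there is $g\in G$ with $d(gx,gy)>\epsilon$. Two systems are conjugate ($\cong$) if there is a $G$-equivariant homeomorphism between them. For a finite alphabet $\Sigma$, $G$ acts on $\Sigma^G$ (product topology) by $(gx)_h=x_{hg}$. A subshift is a closed $G$-invariant subset of $\Sigma^G$. A subshift $X$ is an SFT if there is a clopen $C\subset\Sigma^G$ such that $x\in X\iff\forall g\in G:\ gx\notin C$. We identify $(\Sigma^2)^G$ with $\Sigma^G\times\Sigma^G$. For subshifts $Y\subset\Sigma^G$, $Z\subset(\Sigma^2)^G$ such that $Z\cap Y^2$ is an equivalence relation on $Y$, $Y/Z$ denotes the topological quotient $Y/(Z\cap Y^2)$ with action $g[y]=[gy]$. A system is $\frac{G\text{-subshift}}{\text{SFT}}$ (respectively $\frac{G\text{-SFT}}{\text{SFT}}$) if it is conjugate to some such $Y/Z$ with $Y$ a subshift (respectively an SFT) and $Z$ an SFT. *)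

(* Defs.v *)
From HB Require Import structures.
From mathcomp Require Import all_boot all_order all_algebra.
From mathcomp Require Import all_classical all_reals topology function_spaces.

Set Implicit Arguments.
Unset Strict Implicit.
Unset Printing Implicit Defensive.

Import Order.TTheory GRing.Theory Num.Theory.

Local Open Scope classical_set_scope.
Local Open Scope card_scope.
Local Open Scope quotient_scope.
Local Open Scope ring_scope.

Section Groups.
Variable G : groupType.

Definition generated_subgroup (S : set G) : set G :=
  smallest (fun H : set G => group_closed [in H]) S.

Definition finitely_generated : Prop :=
  exists2 S : set G, finite_set S & generated_subgroup S = [set: G].

Definition finite_index (H : set G) : Prop :=
  finite_set (range (fun x : G => [set (x * h)%g | h in H])).

Definition virtually_cyclic : Prop :=
  exists g : G, finite_index (generated_subgroup [set g]).

End Groups.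

Section Topology.
Variable R : realType.

Record compatible_metric (X : topologicalType) (d : X -> X -> R) : Prop := {
  cmetric_refl : forall x, d x x = 0;
  cmetric_sep : forall x y, d x y = 0 -> x = y;
  cmetric_sym : forall x y, d x y = d y x;
  cmetric_triangle : forall y x z, d x z <= d x y + d y z;
  cmetric_nbhs : forall x, nbhs x = nbhs_ball_ (fun x e => [set y | d x y < e]) x
}.

Definition metrizable (X : topologicalType) : Prop :=
  exists d : X -> X -> R, compatible_metric d.

Definition compact_metrizable (X : topologicalType) : Prop :=
  compact [set: X] /\ metrizable X.

End Topology.

Definition open_cover (X : topologicalType) (U : set (set X)) : Prop :=
  U `<=` open /\ \bigcup_(A in U) A = [set: X].

Definition refines (X : Type) (V U : set (set X)) : Prop :=
  forall B, V B -> exists2 A, U A & B `<=` A.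

(* Lebesgue covering dimension at most n (also satisfied by the empty space,
   of dimension -1) *)
Definition covering_dim_le (X : topologicalType) (n : nat) : Prop :=
  forall U : set (set X), open_cover U ->
  exists V : set (set X), [/\ open_cover V, refines V U &
    forall x : X, [set B | V B /\ B x] #<= `I_n.+1].

Definition infinite_dimensional (X : topologicalType) : Prop :=
  forall n : nat, ~ covering_dim_le X n.

(* homeomorphism onto the image: injective, and the topology of K is the one
   induced from X through f *)
Definition embedding (K X : topologicalType) (f : K -> X) : Prop :=
  injective f /\
  forall A : set K, open A <-> exists2 B : set X, open B & A = f @^-1` B.

Definition contains_copy (X K : topologicalType) : Prop :=
  exists f : K -> X, embedding f.

(* By the action laws, each [gact g] is then a homeomorphism, with inverse
   [gact g^-1]. *)
Record gspace (G : groupType) := GSpace {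
  gcarrier :> topologicalType;
  gact : G -> gcarrier -> gcarrier;
  gact1 : forall x, gact 1%g x = x;
  gactM : forall g h x, gact (g * h)%g x = gact g (gact h x);
  gact_continuous : forall g, continuous (gact g)
}.

Record dynsys (R : realType) (G : groupType) := DynSys {
  dynsys_gspace :> gspace G;
  dynsys_compact_metrizable : compact_metrizable R dynsys_gspace
}.

Definition expansive (R : realType) (G : groupType) (X : dynsys R G) : Prop :=
  exists2 d : X -> X -> R, compatible_metric d &
  exists2 e : R, 0 < e &
  forall x y : X, x <> y -> exists g : G, e < d (gact g x) (gact g y).

Definition conjugate (G : groupType) (X Y : gspace G) : Prop :=
  exists (f : X -> Y) (f' : Y -> X),
    [/\ cancel f f' /\ cancel f' f, continuous f, continuous f' &
        forall g x, f (gact g x) = gact g (f x)].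

Section Restriction.
Variables (G : groupType) (X : gspace G) (A : set X).

Definition invariant : Prop := forall g x, A x -> A (gact g x).

Hypothesis invA : invariant.

Definition restr_act (g : G) (x : A) : A :=
  exist _ (gact g (\val x)) (mem_set (invA g (set_mem (valP x)))).

Lemma restr_act1 x : restr_act 1%g x = x.
Proof. by apply: val_inj; rewrite /= gact1. Qed.

Lemma restr_actM g h x :
  restr_act (g * h)%g x = restr_act g (restr_act h x).
Proof. by apply: val_inj; rewrite /= gactM. Qed.

Lemma restr_act_continuous g : continuous (restr_act g).
Proof.
apply: continuous_comp_initial => x.
apply: (@continuous_comp _ _ _ (set_val : A -> X) (gact g)).
  exact: initial_continuous.
exact: gact_continuous.
Qed.

Definition restriction : gspace G :=
  @GSpace G (A : Type) restr_act restr_act1 restr_actM restr_act_continuous.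

End Restriction.

Section Quotient.
Variables (G : groupType) (X : gspace G) (E : equiv_rel X).
Hypothesis invE : forall g x y, E x y -> E (gact g x) (gact g y).

Local Notation Q := (quotient_topology {eq_quot E}).

Definition quot_act (g : G) (q : Q) : Q := \pi_Q (gact g (repr q)).

Lemma quot_act_pi g (x : X) : quot_act g (\pi_Q x) = \pi_Q (gact g x).
Proof.
apply/eqmodP/invE; apply/eqmodP.
exact: (reprK (\pi_Q x : Q)).
Qed.

Lemma quot_act1 q : quot_act 1%g q = q.
Proof. by rewrite /quot_act gact1 reprK. Qed.

Lemma quot_actM g h q : quot_act (g * h)%g q = quot_act g (quot_act h q).
Proof. by rewrite {1 3}/quot_act quot_act_pi gactM. Qed.

Lemma quot_act_continuous g : continuous (quot_act g).
Proof.
apply/quotient_continuous.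
have -> : quot_act g \o \pi_Q = \pi_Q \o gact g.
  by apply/funext => x; exact: quot_act_pi.
move=> x; apply: continuous_comp; first exact: gact_continuous.
exact: pi_continuous.
Qed.

Definition quotient : gspace G :=
  @GSpace G Q quot_act quot_act1 quot_actM quot_act_continuous.

End Quotient.

Section Shifts.
Variables (G : groupType) (S : finType).

Definition shift_space := {ptws G -> discrete_topology S}.

Definition shift (g : G) (x : shift_space) : shift_space :=
  fun h => x (h * g)%g.

Lemma shift1 x : shift 1%g x = x.
Proof. by apply/funext => h; rewrite /shift mulg1. Qed.

Lemma shiftM g h x : shift (g * h)%g x = shift g (shift h x).
Proof. by apply/funext => k; rewrite /shift mulgA. Qed.

Lemma shift_continuous g : continuous (shift g).
Proof.
move=> x; have FF : Filter (shift g y @[y --> x]) by exact: (@fmap_filter _ _ _ _ (nbhs_filter x)).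
apply/cvg_sup => h U [/= V [[B oB <-] Bx] BU].
apply: (filterS BU).
exact: (@proj_continuous G (fun=> discrete_topology S) (h * g)%g x _
  (open_nbhs_nbhs (conj oB Bx))).
Qed.

Definition full_shift : gspace G :=
  @GSpace G shift_space shift shift1 shiftM shift_continuous.

Definition is_subshift (Y : set full_shift) : Prop :=
  closed Y /\ invariant Y.

Definition is_SFT (Y : set full_shift) : Prop :=
  is_subshift Y /\
  exists2 C : set full_shift, clopen C &
    forall x, Y x <-> forall g, ~ C (gact g x).

End Shifts.

Section SubshiftQuotient.
Variables (G : groupType) (S : finType).

Definition pair_config (x y : full_shift G S) : full_shift G (S * S)%type :=
  fun g => (x g, y g).

Variables (Y : set (full_shift G S)) (Z : set (full_shift G (S * S)%type)).

(* the relation Z `&` Y^2 on Y *)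
Definition subshift_rel : rel Y :=
  fun y y' => `[< Z (pair_config (\val y) (\val y')) >].

Definition is_equivalence_on : Prop :=
  [/\ reflexive subshift_rel, symmetric subshift_rel & transitive subshift_rel].

Hypotheses (subY : is_subshift Y) (subZ : is_subshift Z).
Hypothesis eqvZ : is_equivalence_on.

Definition subshift_equiv : equiv_rel (restriction subY.2) :=
  EquivRel subshift_rel (let: And3 r _ _ := eqvZ in r)
    (let: And3 _ s _ := eqvZ in s) (let: And3 _ _ t := eqvZ in t).

Lemma subshift_equiv_invariant g x y : subshift_equiv x y ->
  subshift_equiv (gact g x) (gact g y).
Proof.
move=> /asboolP Zxy; apply/asboolP.
exact: (subZ.2 g _ Zxy).
Qed.

Definition subshift_quotient : gspace G := quotient subshift_equiv_invariant.

End SubshiftQuotient.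

Definition subshift_over_SFT (G : groupType) (X : gspace G) : Prop :=
  exists (S : finType) (Y : set (full_shift G S))
    (Z : set (full_shift G (S * S)%type))
    (subY : is_subshift Y) (sftZ : is_SFT Z) (eqvZ : is_equivalence_on Y Z),
  conjugate X (subshift_quotient subY sftZ.1 eqvZ).

Definition SFT_over_SFT (G : groupType) (X : gspace G) : Prop :=
  exists (S : finType) (Y : set (full_shift G S))
    (Z : set (full_shift G (S * S)%type))
    (sftY : is_SFT Y) (sftZ : is_SFT Z) (eqvZ : is_equivalence_on Y Z),
  conjugate X (subshift_quotient sftY.1 sftZ.1 eqvZ).

(* Main.v *)
(** An action of a virtually cyclic group is expansive only if a single
    homeomorphism is, and then Mañé's argument bounds the dimension. The kernel
    of a factor map of a subshift being an SFT makes the factor expansive, by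
    compactness. A space containing all cubes is infinite-dimensional, by
    Sperner's lemma.

    For the construction, suppose that G carries a map phi, moving points by
    finitely many left multiplications, which is injective and misses
    infinitely many points, so that there are infinitely many disjoint forward
    orbits (rays). Put at each h in G an arrow towards phi h and a binary
    digit; reading the digits along the arrows gives an angle in R/Z, which
    doubles along each arrow. Identifying configurations with equal arrows and
    angles is an SFT condition, because a nonzero difference of angles grows
    until it is visible. When the arrows follow phi the angles at the starting
    points of the rays are free, so that the quotient contains a Hilbert cube.

    If G has an element g of infinite order and is not virtually cyclic, one
    takes for phi the multiplication by g on half of each right coset of <g>.
    If G is an infinite torsion group, it has quadratic growth by the
    Morse-Hedlund argument, so that the boundaries of finite sets grow with
    their size, and Hall's theorem provides an injective phi missing any
    sufficiently sparse sequence. *)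

From mathcomp Require Import fingroup perm.
Require Import Defs.
From HB Require Import structures.
From mathcomp Require Import all_boot all_order all_algebra.
From mathcomp Require Import all_classical all_reals topology function_spaces.
From mathcomp Require Import normedtype.
From mathcomp Require Import zify ring lra.

Set Implicit Arguments.
Unset Strict Implicit.
Unset Printing Implicit Defensive.

Import Order.TTheory GRing.Theory Num.Theory.
Import numFieldNormedType.Exports.

Local Open Scope classical_set_scope.
Local Open Scope card_scope.
Local Open Scope quotient_scope.
Local Open Scope ring_scope.

(** * Compact metrizable spaces *)

(** The arrows belong to the configuration and are unconstrained, so the subshift is the full shift
    and no local rule has to produce phi: a single good phi, frozen into the arrows, already yields
    all the embeddings. Injectivity of phi matters because the angle at a point determines all
    angles further along its orbit; if two rays merged, their starting angles would be tied
    together.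

    The angle is taken modulo 1 since the doubling of angles is continuous there and expands small
    distances. Digits themselves could not be compared locally: two expansions of the same angle may
    differ everywhere from some place on.

    In the torsion case the growth is used by averaging. A finite set F with boundary smaller than D
    is moved by at most half by every element of a ball of radius about |F|/2D; counting pairs in F
    bounds that ball by 2|F|, which is linear in the radius and contradicts quadratic growth. In
    Hall's condition every starting point near F costs one neighbour, and the boundary of F has to
    pay for it. *)

Lemma compact_finite_subcover (X : topologicalType) (A : set X)
    (I : choiceType) (f : I -> set X) :
  compact A -> (forall i, open (f i)) -> (forall x, A x -> exists i, f i x) ->
  exists s : seq I, forall x, A x -> exists2 i, i \in s & f i x.
Proof.
(* [compact_cover] is applied to a pointed space, so the empty space is split off. *)
move=> cA fop fcov; have [[x0]|noX] := pselect (exists x : X, True); last first.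
  by exists [::] => x; case: noX; exists x.
pose X' : ptopologicalType := HB.pack X (isPointed.Build X x0).
have : @compact X' A by [].
rewrite compact_cover => /(_ I setT f) [i _||s _ sf]; first exact: fop.
  by move=> x /fcov [i fi]; exists i.
by exists (finmap.enum_fset s) => x /sf [i si fx]; exists i.
Qed.

Lemma exp2V_lt (R : realType) (e : R) : 0 < e -> exists n, 2 ^- n < e.
Proof.
move=> e0; have [n ne] : exists n : nat, e^-1 < n%:R.
  by exists (Num.bound e^-1); apply: archi_boundP; rewrite invr_ge0 ltW.
exists n; rewrite -[e]invrK ltf_pV2 ?posrE ?invr_gt0 ?exprn_gt0 //.
apply: lt_trans ne _; rewrite -natrX ltr_nat; exact: ltn_expl.
Qed.

Section Metric.
Variables (R : realType) (X : topologicalType) (d : X -> X -> R).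
Hypothesis dX : compatible_metric d.

Lemma cmetric_ge0 x y : 0 <= d x y.
Proof.
have := cmetric_triangle dX y x x.
by rewrite (cmetric_refl dX) (cmetric_sym dX y x); lra.
Qed.

Lemma cmetric_gt0 x y : x <> y -> 0 < d x y.
Proof.
move=> xy; rewrite lt_neqAle cmetric_ge0 andbT; apply/eqP => d0.
by apply: xy; exact: (cmetric_sep dX).
Qed.

Lemma cmetric_nbhsP x (A : set X) :
  nbhs x A <-> exists2 e, 0 < e & forall y, d x y < e -> A y.
Proof.
by rewrite (cmetric_nbhs dX); split=> -[e /= e0 h]; exists e.
Qed.

Lemma cmetric_ball_open x e : open [set y | d x y < e].
Proof.
rewrite openE => y /= xy; apply/cmetric_nbhsP; exists (e - d x y); first by lra.
by move=> z yz /=; have := cmetric_triangle dX y x z; lra.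
Qed.

Lemma cmetric_hausdorff : hausdorff_space X.
Proof.
move=> x y xy; apply: contrapT => /cmetric_gt0 d0.
have nx : nbhs x [set z | d x z < d x y / 2].
  by apply/cmetric_nbhsP; exists (d x y / 2) => //; lra.
have ny : nbhs y [set z | d y z < d x y / 2].
  by apply/cmetric_nbhsP; exists (d x y / 2) => //; lra.
have [z [/= xz yz]] := xy _ _ nx ny.
have := cmetric_triangle dX z x y; rewrite (cmetric_sym dX z y); lra.
Qed.

Hypothesis cX : compact [set: X].

Lemma lebesgue_number (U : set (set X)) : open_cover U ->
  exists2 e, 0 < e & forall x, exists2 A, U A & forall y, d x y < e -> A y.
Proof.
move=> [Uop Ucov].
have /choice[r rP] (x : X) : exists r : R,
    0 < r /\ exists2 A, U A & forall y, d x y < r -> A y.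
  have [A UA Ax] : (\bigcup_(A in U) A) x by rewrite Ucov.
  have /cmetric_nbhsP[e e0 eA] : nbhs x A by apply: open_nbhs_nbhs; split=> //; exact: Uop.
  by exists e; split=> //; exists A.
have [s sP] := @compact_finite_subcover X setT X
  (fun x => [set y | d x y < r x / 2]) cX (fun x => cmetric_ball_open x _)
  (fun x _ => ex_intro _ x (etrans (congr1 (fun z => z < r x / 2)
    (cmetric_refl dX x)) (divr_gt0 (rP x).1 (ltr0Sn _ 1)))).
(* With halved radii, a point within [m] of [x] remains in the full ball around the centre that
   covers [x]. *)
pose m := \big[Order.min/1]_(x <- s) (r x / 2).
exists m.
  rewrite /m; elim: (s) => [|x t IHt]; rewrite ?big_nil // big_cons lt_min IHt.
  by rewrite andbT; have := (rP x).1; lra.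
move=> x; have [y ys /= yx] := sP x I.
have [_ [A UA Ay]] := rP y; exists A => // z xz; apply: Ay.
have my : m <= r y / 2 by rewrite /m; exact: ge_bigmin_seq.
by have := cmetric_triangle dX x y z; lra.
Qed.

Lemma cmetric_totally_bounded e : 0 < e ->
  exists s : seq X, forall x, exists2 c, c \in s & d c x < e.
Proof.
move=> e0; have [|x _|s sP] := @compact_finite_subcover X setT X
  (fun x => [set y | d x y < e]) cX; first by move=> x; exact: cmetric_ball_open.
  by exists x; rewrite /= (cmetric_refl dX).
by exists s => x; exact: sP.
Qed.

End Metric.

Lemma cmetric_unif_continuous (R : realType) (X Y : topologicalType)
    (d : X -> X -> R) (dY : Y -> Y -> R) (f : X -> Y) :
  compatible_metric d -> compact [set: X] -> compatible_metric dY ->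
  continuous f ->
  forall e, 0 < e -> exists2 r, 0 < r &
    forall x y, d x y < r -> dY (f x) (f y) < e.
Proof.
move=> dX cX dYP cf e e0.
pose U : set (set X) := range (fun x => f @^-1` [set y | dY (f x) y < e / 2]).
have [|r r0 rP] := lebesgue_number dX cX (U := U).
  split=> [_ [x _ <-]|].
    apply: open_comp; first by move=> *; exact: cf.
    exact: (cmetric_ball_open dYP).
  apply/seteqP; split=> // x _.
  exists (f @^-1` [set y | dY (f x) y < e / 2]); first by exists x.
  by rewrite /= (cmetric_refl dYP); lra.
exists r => // x y xy; have [_ [z _ <-] /= zP] := rP x.
have zx := zP x; rewrite (cmetric_refl dX) in zx.
have := zx r0; have := zP y xy.
have := cmetric_triangle dYP (f z) (f x) (f y).
by rewrite (cmetric_sym dYP (f x) (f z)); lra.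
Qed.

Lemma compact_embedding (K X : topologicalType) (f : K -> X) :
  compact [set: K] -> hausdorff_space X -> continuous f -> injective f ->
  embedding f.
Proof.
move=> cK hX cf fI; split=> // A; split=> [oA|[B oB ->]]; last first.
  by apply: open_comp => // *; exact: cf.
exists (~` (f @` (~` A))).
  apply: closed_openC; apply: compact_closed => //.
  apply: continuous_compact; first by move=> x; apply: continuous_subspaceT => y; exact: cf.
  apply: (subclosed_compact _ cK) => //; exact: open_closedC.
apply/seteqP; split=> x /=; first by move=> Ax [y nAy /fI yx]; apply: nAy; rewrite yx.
by move=> h; apply: contrapT => nAx; apply: h; exists x.
Qed.

(** * Sperner's lemma on the cubical grid *)

Lemma addF2 (x : 'F_2) : x + x = 0.
Proof. by apply: addrr_pchar2; rewrite pchar_Fp. Qed.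

(** Applied to label matrices, this is the boundary formula of Sperner's lemma: the determinant of a
    simplex becomes the sum over its facets. It compares the two ways of summing the last row of
    [\adj A *m A]. *)
Lemma det_sum_cofactor (R : comNzRingType) n (A : 'M[R]_n.+1) :
  (forall i, \sum_j A i j = 1) -> \det A = \sum_i cofactor A i ord_max.
Proof.
move=> A1; transitivity (\sum_j ((\adj A) *m A) ord_max j).
  rewrite mul_adj_mx (bigD1 ord_max) //= big1 ?addr0.
    by rewrite !mxE eqxx mulr1n.
  by move=> j /negPf nj; rewrite !mxE eq_sym nj mulr0n.
under eq_bigr do rewrite mxE.
rewrite exchange_big /=; apply: eq_bigr => i _.
by rewrite -mulr_sumr A1 mulr1 !mxE.
Qed.

Lemma det_col0 (R : comNzRingType) n (A : 'M[R]_n) j :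
  (forall i, A i j = 0) -> \det A = 0.
Proof.
by move=> A0; rewrite (expand_det_col _ j) big1 // => i _; rewrite A0 mul0r.
Qed.

Section Sperner.
Variables (D M : nat) (lab : {ffun 'I_D -> nat} -> nat).
Hypothesis M_gt0 : (0 < M)%N.
Hypothesis lab_le : forall w, (lab w <= D)%N.
Hypothesis lab0 : forall w c, lab w = 0%N -> (w c != M)%N.
Hypothesis labS : forall w (c : 'I_D), lab w = c.+1 -> (0 < w c)%N.

(* The Kuhn simplex with lowest corner [v] whose coordinates increase in the
   order given by [r] has vertices [vert v r 0], ..., [vert v r D]. *)
Definition vert (v : {ffun 'I_D -> nat}) (r : 'S_D) (j : nat) :
  {ffun 'I_D -> nat} := [ffun c => v c + (r c < j)]%N.

Definition natf (v : {ffun 'I_D -> 'I_M}) : {ffun 'I_D -> nat} :=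
  [ffun c => nat_of_ord (v c)].

Definition flat_pt k (v : {ffun 'I_D -> 'I_M}) :=
  [forall c : 'I_D, (k <= c)%N ==> (v c == 0 :> nat)].

Definition flat_perm k (r : 'S_D) :=
  [forall c : 'I_D, (k <= c)%N ==> (r c == c)].

(** Each row has at most one nonzero entry, so the determinant modulo 2 is 1 exactly when the labels
    of the vertices are 0, ..., k in some order. *)
Definition labmx k v r : 'M['F_2]_k.+1 :=
  \matrix_(j, i) (lab (vert v r j) == i)%:R.

(* Number modulo 2 of the fully labelled simplices in the face spanned by the
   first [k] directions. *)
Definition full_count k : 'F_2 :=
  \sum_(v | flat_pt k v) \sum_(r | flat_perm k r) \det (labmx k (natf v) r).

(** The facet opposite vertex [j] of a simplex with [k.+2] vertices, tested for the labels 0, ...,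
    k. *)
Definition face k v r (j : nat) : 'M['F_2]_k.+1 :=
  \matrix_(j', i) (lab (vert v r (bump j j')) == i)%:R.

Lemma flat_permP k r (c : 'I_D) : flat_perm k r -> (k <= c)%N -> r c = c.
Proof. by move=> /forallP /(_ c) /implyP h /h /eqP. Qed.

Lemma flat_perm_lt k r (c : 'I_D) : flat_perm k r -> (r c < k)%N = (c < k)%N.
Proof.
move=> fr; case: (ltnP c k) => [ck|kc]; last first.
  by rewrite (flat_permP fr kc) ltnNge kc.
case: (ltnP (r c) k) => // krc.
by have /perm_inj rc := flat_permP fr krc; move: ck krc; rewrite rc; lia.
Qed.

(** All coordinates from [k] on vanish at such a vertex, and [labS] forbids the label [c.+1] where
    coordinate [c] vanishes. *)
Lemma flat_lab k v r j : flat_pt k v -> flat_perm k r -> (j <= k)%N ->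
  (lab (vert (natf v) r j) <= k)%N.
Proof.
move=> fv fr jk; rewrite leqNgt; apply/negP => klab.
set w := vert _ _ _ in klab.
have lt_lab : ((lab w).-1 < D)%N by have := lab_le w; lia.
have := @labS w (Ordinal lt_lab).
have lab1 : lab w = (Ordinal lt_lab).+1 by rewrite /=; lia.
move=> /(_ lab1); rewrite /w !ffunE.
move: fv => /forallP /(_ (Ordinal lt_lab)) /implyP /=.
have kc : (k <= (lab w).-1)%N by lia.
move=> /(_ kc) /eqP ->; rewrite (flat_permP fr) //= add0n lt0b /= => lj.
by move: (leq_trans lj jk); rewrite -/w; lia.
Qed.

Lemma det_labmx k v r : flat_pt k.+1 v -> flat_perm k.+1 r ->
  \det (labmx k.+1 (natf v) r) = \sum_(j < k.+2) \det (face k (natf v) r j).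
Proof.
move=> fv fr; rewrite det_sum_cofactor.
  apply: eq_bigr => j _; rewrite /cofactor.
  have -> : (-1 : 'F_2) = 1 by apply/eqP; rewrite eq_sym -subr_eq0 opprK addF2.
  rewrite expr1n mul1r; congr (\det _); apply/matrixP => a b.
  by rewrite !mxE lift_max.
move=> j; have lab_lt : (lab (vert (natf v) r j) < k.+2)%N.
  by rewrite ltnS flat_lab // -ltnS.
rewrite (bigD1 (Ordinal lab_lt)) //= big1 ?addr0 ?mxE ?eqxx //.
move=> i /eqP ni; rewrite mxE; case: eqP => // e.
by case: ni; apply/val_inj.
Qed.

(** A facet opposite an intermediate vertex is shared by the two simplices of the same grid cube
    whose orders differ by exchanging the places [j.-1] and [j]; they cancel modulo 2. *)
Lemma sum_face_inner k v (j : nat) : (k < D)%N -> (0 < j < k.+1)%N ->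
  \sum_(r | flat_perm k.+1 r) \det (face k v r j) = 0.
Proof.
move=> kD /andP[j0 jk].
have jD : (j < D)%N by lia.
have j1D : (j.-1 < D)%N by lia.
set t := tperm (Ordinal j1D) (Ordinal jD).
have flat_t r : flat_perm k.+1 (r * t)%g = flat_perm k.+1 r.
  have ft : forall c : 'I_D, (k.+1 <= c)%N -> t c = c.
    by move=> c kc; rewrite tpermD // -val_eqE /=; lia.
  apply/forallP/forallP => h c; apply/implyP => kc; have /implyP/(_ kc) := h c;
    rewrite permM => /eqP; last by move=> ->; rewrite ft.
  by move=> e; apply/eqP; apply: (@perm_inj _ t); rewrite e ft.
have face_t r : face k v (r * t)%g j = face k v r j.
  apply/matrixP => a b; rewrite !mxE; congr (_ == _)%:R; congr lab.
  apply/ffunP => c; rewrite !ffunE permM; congr (_ + nat_of_bool _)%N.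
  set x := bump j a; have xj : x <> j by rewrite /x /bump; lia.
  by case: tpermP => [->|->|//] /=; lia.
have odd_t r : odd_perm (r * t)%g = ~~ odd_perm r.
  by rewrite odd_permM odd_tperm -val_eqE /= (_ : j.-1 != j) ?addbT //; lia.
(* Parity selects one simplex of each pair. *)
rewrite (bigID (@odd_perm _)) /=.
rewrite [X in _ + X](reindex_inj (mulIg t)) /=.
rewrite [X in _ + X](eq_bigl (fun r => flat_perm k.+1 r && odd_perm r)).
  by under [X in _ + X]eq_bigr do rewrite face_t; rewrite addF2.
by move=> r; rewrite flat_t odd_t negbK.
Qed.

Lemma rotation_ex k : (k < D)%N -> exists t : 'S_D, forall i : 'I_D,
  t i = (if i == 0 :> nat then k else if (i <= k)%N then i.-1 else i) :> nat.
Proof.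
move=> kD.
pose f (i : nat) := (if i == 0%N then k else if (i <= k)%N then i.-1 else i)%N.
have fD (i : 'I_D) : (f i < D)%N.
  by rewrite /f; case: ifP => // _; have := ltn_ord i; case: ifP; lia.
have f_inj : injective (fun i : 'I_D => Ordinal (fD i)).
  move=> i j /(congr1 val) /= fij; apply/val_inj => /=; move: fij.
  by rewrite /f; do 4? case: ifP => ?; lia.
by exists (perm f_inj) => i; rewrite permE.
Qed.

Definition raise k (r : 'S_D) (v : {ffun 'I_D -> nat}) : {ffun 'I_D -> nat} :=
  [ffun c => v c + (r c == k :> nat)]%N.

(** Without its lowest vertex, a simplex starts one step along its first direction. Rotating that
    direction to the last place exhibits the facet as the one opposite the top vertex of a simplex
    based at the shifted corner. *)
Lemma sum_face_first k v : (k < D)%N ->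
  \sum_(r | flat_perm k.+1 r) \det (face k v r 0) =
  \sum_(r | flat_perm k.+1 r) \det (labmx k (raise k r v) r).
Proof.
move=> kD; have [t tE] := rotation_ex kD.
have ft (c : 'I_D) : (k.+1 <= c)%N -> t c = c.
  by move=> kc; apply/val_inj; rewrite /= tE; do 2? case: ifP => ?; lia.
rewrite [RHS](reindex_inj (mulIg t)) /=; apply: eq_big => r.
  apply/forallP/forallP => h c; apply/implyP => kc; have /implyP/(_ kc) := h c;
    rewrite permM => /eqP; first by move=> ->; rewrite ft.
  by move=> e; apply/eqP; apply: (@perm_inj _ t); rewrite e ft.
move=> _; congr (\det _); apply/matrixP => a b; rewrite !mxE.
congr (_ == _)%:R; congr lab; apply/ffunP => c; rewrite !ffunE permM -addnA.
congr (_ + _)%N; rewrite tE /bump; have := ltn_ord a.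
by do 2? case: ifP => ?; lia.
Qed.

Lemma sum_face_last k v r : \det (face k v r k.+1) = \det (labmx k v r).
Proof.
congr (\det _); apply/matrixP => a b; rewrite !mxE /bump.
by rewrite leqNgt ltn_ord.
Qed.

Definition setf (c : 'I_D) (m : nat) (v : {ffun 'I_D -> nat}) :
  {ffun 'I_D -> nat} := [ffun x => if x == c then m else v x].

(** On each grid line in direction [c] the inner terms occur twice and cancel modulo 2, which leaves
    the ends 0 and [M]. The lines are indexed by their points with [c]-coordinate 0. *)
Lemma telescope_direction (g : {ffun 'I_D -> nat} -> 'F_2) k (c : 'I_D) :
  (c < k)%N ->
  \sum_(v | flat_pt k v) (g (natf v) + g (setf c (v c).+1 (natf v))) =
  \sum_(v | flat_pt k v && (v c == 0 :> nat)) (g (natf v) + g (setf c M (natf v))).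
Proof.
move=> ck; pose o0 := Ordinal M_gt0.
pose set_c (m : 'I_M) (v : {ffun 'I_D -> 'I_M}) : {ffun 'I_D -> 'I_M} :=
  [ffun x => if x == c then m else v x].
have flat_set m v : flat_pt k (set_c m v) = flat_pt k v.
  apply: eq_forallb => x; rewrite ffunE; have [->|//] := eqVneq x c.
  by rewrite leqNgt ck.
rewrite (partition_big (set_c o0)
  (fun v => flat_pt k v && (v c == 0 :> nat))) /=; last first.
  by move=> v fv; rewrite flat_set fv ffunE eqxx.
apply: eq_bigr => v /andP[fv /eqP v0].
transitivity (\sum_(m < M) (g (setf c m (natf v)) + g (setf c m.+1 (natf v)))).
  rewrite (reindex_onto (set_c^~ v) (fun u => u c)) /=; last first.
    move=> u /andP[fu /eqP euv]; apply/ffunP => x; rewrite ffunE.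
    by case: eqP => [->//|/eqP/negPf nx]; rewrite -euv ffunE nx.
  apply: eq_big => [m|m _].
    rewrite flat_set fv ffunE !eqxx andbT /=; apply/eqP/ffunP => x.
    rewrite !ffunE; case: eqP => // ->; apply/val_inj => /=; by rewrite v0.
  by congr (g _ + g _); apply/ffunP => x; rewrite !ffunE ?eqxx; case: eqP.
have -> : natf v = setf c 0 (natf v).
  by apply/ffunP => x; rewrite !ffunE; case: eqP => // ->.
have setfK m m' w : setf c m (setf c m' w) = setf c m w.
  by apply/ffunP => x; rewrite !ffunE; case: eqP.
rewrite setfK; under eq_bigr do rewrite !setfK.
rewrite -(big_mkord xpredT (fun m =>
  g (setf c m (natf v)) + g (setf c m.+1 (natf v)))).
elim: (M) => [|m IHm]; first by rewrite big_nil addF2.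
rewrite big_nat_recr //= IHm addrA -[X in X + _]addrA addF2 addr0.
by [].
Qed.

(** The inductive step of Sperner's lemma: all facets cancel except those on the outer boundary, and
    there the label conditions kill every side but the one where the last coordinate is 0. *)
Lemma full_countS k : (k < D)%N -> full_count k.+1 = full_count k.
Proof.
move=> kD; pose o := Ordinal kD.
transitivity (\sum_(v | flat_pt k.+1 v) \sum_(r | flat_perm k.+1 r)
   (\det (labmx k (natf v) r) + \det (labmx k (raise k r (natf v)) r))).
  apply: eq_bigr => v fv.
  under eq_bigr => r fr do rewrite det_labmx //.
  rewrite exchange_big big_ord_recl big_ord_recr /=.
  rewrite [X in _ + (X + _)]big1 ?add0r => [|j _]; last first.
    by rewrite sum_face_inner // /bump add1n /= ltnS ltn_ord.
  rewrite sum_face_first // addrC big_split /=; congr (_ + _).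
  by apply: eq_bigr => r _; rewrite /bump add1n sum_face_last.
rewrite exchange_big /full_count [RHS]exchange_big /=.
transitivity (\sum_(r | flat_perm k.+1 r) \sum_(v | flat_pt k.+1 v &&
    (v ((r^-1)%g o) == 0 :> nat)) \det (labmx k (natf v) r)).
  apply: eq_bigr => r fr; set c := (r^-1)%g o.
  have rc : r c = o by rewrite /c permKV.
  have ck : (c < k.+1)%N by rewrite -(flat_perm_lt c fr) rc.
  under eq_bigr => v _.
    rewrite (_ : raise k r (natf v) = setf c (v c).+1 (natf v)); last first.
      apply/ffunP => x; rewrite !ffunE; have [->|xc] := eqVneq x c.
        by rewrite rc eqxx addn1.
      rewrite (_ : (_ == k) = false) ?addn0 //; apply: contra_neqF xc => /eqP e.
      by apply: (@perm_inj _ r); rewrite rc; apply/val_inj.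
    over.
  rewrite (telescope_direction (fun v => \det (labmx k v r))) //.
  rewrite big_split /= [X in _ + X]big1 ?addr0 // => v _.
  (* On the side where coordinate [c] equals [M], [lab0] excludes the label 0. *)
  apply: (det_col0 (j := ord0)) => j; rewrite mxE.
  case: eqP => // e; have := lab0 c e; rewrite !ffunE eqxx rc /=.
  by rewrite (_ : (k < j)%N = false) ?addn0 ?eqxx //; have := ltn_ord j; lia.
rewrite [LHS](bigID (fun r : 'S_D => (r^-1)%g o == o)) /= [X in _ + X]big1 ?addr0.
  have flatS (r : 'S_D) : flat_perm k.+1 r && ((r^-1)%g o == o) = flat_perm k r.
    apply/andP/idP => [[fr /eqP ro]|fr].
      apply/forallP => c; apply/implyP => kc; have [->|co] := eqVneq c o.
        by rewrite -{1}ro permKV.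
      rewrite (flat_permP fr) // ltn_neqAle kc andbT.
      by apply: contra co => /eqP e; apply/eqP/val_inj.
    split; last by rewrite -{1}(@flat_permP k r o fr) // permK.
    apply/forallP => c; apply/implyP => kc.
    by rewrite (flat_permP fr) // ltnW.
  apply: eq_big => [r|r /andP[fr /eqP ro]]; first exact: flatS.
  rewrite ro; apply: eq_bigl => v; apply/andP/idP => [[fv v0]|fv].
    apply/forallP => c; apply/implyP => kc; have [->//|co] := eqVneq c o.
    move: fv => /forallP/(_ c)/implyP; apply; rewrite ltn_neqAle kc andbT.
    by apply: contra co => /eqP e; apply/eqP/val_inj.
  split; last by move: fv => /forallP/(_ o)/implyP; apply.
  apply/forallP => c; apply/implyP => kc.
  by move: fv => /forallP/(_ c)/implyP; apply; exact: ltnW.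
(* On the side where coordinate [c] is 0 with [c < k], [labS] excludes the label [c.+1], so that
   column vanishes. *)
move=> r /andP[fr ro]; apply: big1 => v /andP[fv /eqP v0].
set c := (r^-1)%g o in ro v0.
have rc : r c = o by rewrite /c permKV.
have ck : (c < k)%N.
  rewrite ltn_neqAle -ltnS -(flat_perm_lt c fr) rc /= ltnS leqnn andbT.
  by apply: contra ro => /eqP e; apply/eqP/val_inj.
have ck1 : (c.+1 < k.+1)%N by [].
apply: (det_col0 (j := Ordinal ck1)) => j; rewrite mxE.
case: eqP => // e; have := @labS _ c e; rewrite !ffunE v0 rc /=.
by rewrite (_ : (k < j)%N = false) //; have := ltn_ord j; lia.
Qed.

Lemma full_count0 : full_count 0 = 1.
Proof.
have f0 : flat_pt 0 [ffun=> Ordinal M_gt0].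
  by apply/forallP => c; rewrite ffunE.
have f1 : flat_perm 0 1%g by apply/forallP => c; rewrite perm1 eqxx implybT.
rewrite /full_count (big_pred1 [ffun=> Ordinal M_gt0]) => [|v]; last first.
  apply/idP/eqP => [/forallP fv|-> //]; apply/ffunP => c; apply/val_inj.
  by rewrite ffunE; apply/eqP/(implyP (fv c)).
rewrite (big_pred1 1%g) => [|r].
  rewrite det_mx11 mxE; have := flat_lab f0 f1 (leqnn 0).
  by rewrite leqn0 => ->.
apply/idP/eqP => [fr|-> //]; apply/perm.permP => c.
by rewrite perm1 (flat_permP fr).
Qed.

Theorem sperner : exists (v : {ffun 'I_D -> nat}) (r : 'S_D),
  (forall c, (v c < M)%N) /\
  forall i : 'I_D.+1, exists j : 'I_D.+1, lab (vert v r j) = i.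
Proof.
have A1 k : (k <= D)%N -> full_count k = 1.
  elim: k => [|k IHk] kD; first exact: full_count0.
  by rewrite full_countS // IHk // ltnW.
have : full_count D != 0 by rewrite A1 // oner_eq0.
case: (boolP [exists v, [exists r, \det (labmx D (natf v) r) != 0]]); last first.
  move=> none; rewrite /full_count big1 ?eqxx // => v _; apply: big1 => r _.
  apply/eqP; move: none; rewrite negb_exists => /forallP/(_ v).
  by rewrite negb_exists => /forallP/(_ r); rewrite negbK.
move=> /existsP[v /existsP[r d0]] _; exists (natf v), r; split.
  by move=> c; rewrite ffunE.
move=> i; apply: contrapT => nj; move/negP: d0; apply; apply/eqP.
apply: (det_col0 (j := i)) => j; rewrite mxE; case: eqP => // e.
by exfalso; apply: nj; exists j.
Qed.

End Sperner.

(** * The covering dimension of the cube *)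

Lemma compact_set_type (T : topologicalType) (A : set T) :
  compact A -> compact [set: A].
Proof.
move=> cA F FF _.
have AA : F (set_val @^-1` A).
  by apply: (filterS _ (@filterT _ F _)) => x _; exact: (set_mem (valP x)).
have [p [Ap clp]] := cA _ (fmap_proper_filter _ FF) AA.
exists (exist _ p (mem_set Ap) : A); split=> // B C FB [_ [[O oO <-] /= Op OC]].
have [] := clp (set_val @` B) O.
- by rewrite /nbhs /= ; apply: filterS FB => x Bx; exists x.
- exact: open_nbhs_nbhs.
by move=> _ [[x Bx <-] Ox]; exists x; split=> //; exact: OC.
Qed.

Lemma covering_dim_le_embedding (K X : topologicalType) (f : K -> X) n :
  hausdorff_space X -> compact [set: K] -> embedding f ->
  covering_dim_le X n -> covering_dim_le K n.
Proof.
move=> hX cK [fI fop] dimX U [Uop Ucov].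
have cf : continuous f.
  by apply/continuousP => B oB; apply/fop; exists B.
have clf : closed (range f).
  by apply: compact_closed => //; apply: continuous_compact => // x;
    apply: continuous_subspaceT => y; exact: cf.
(* The compact image is closed, so its complement may complete the extended sets to a cover of
   [X]. *)
pose U' := [set B | open B /\ U (f @^-1` B)] `|` [set ~` range f].
have [|V [[Vop Vcov] Vref Vcard]] := dimX U'.
  split=> [B [[]//|->]|]; first exact: closed_openC.
  apply/seteqP; split=> // x _; have [[k _ kx]|nx] := pselect (range f x).
    have [A UA Ak] : (\bigcup_(A in U) A) k by rewrite Ucov.
    have /fop [B oB AB] := Uop _ UA.
    exists B; last by rewrite -kx; move: Ak; rewrite AB.
    by left; split=> //; rewrite -AB.
  by exists (~` range f) => //; right.
(* Nonemptiness discards the traces of members of [V] that refine only the complement of the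
   image. *)
exists [set A | (exists2 B, V B & A = f @^-1` B) /\ A !=set0]; split.
- split=> [A [[B VB ->] _]|]; first by apply/fop; exists B => //; exact: Vop.
  apply/seteqP; split=> // k _.
  have [B VB Bk] : (\bigcup_(B in V) B) (f k) by rewrite Vcov.
  by exists (f @^-1` B) => //; split; [exists B|exists k].
- move=> A [[B VB ->] [k Bk]]; have [A' [[oA' UA']|->] BA'] := Vref _ VB.
    by exists (f @^-1` A') => // x; exact: BA'.
  by have := BA' _ Bk; case; exists k.
move=> k; apply: card_le_trans (Vcard (f k)).
apply: card_le_trans (card_image_le (fun B => f @^-1` B) _).
apply: subset_card_le => A [[[B VB ->] _] Bk].
by exists B.
Qed.

Section Cube.
Variables (R : realType) (n : nat).
Local Notation D := n.+1.

Definition cube := [set x : 'rV[R]_D | forall i, 0 <= x ord0 i <= 1].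

Lemma cube_compact : compact [set: cube].
Proof.
apply: compact_set_type.
have := @rV_compact R D (fun=> `[0, 1]%classic) (fun=> @segment_compact R 0 1).
congr compact; apply/seteqP; split=> x /= h i; have := h i;
  by rewrite ?in_itv /= ?in_itv.
Qed.

Definition cube_dist (x y : cube) : R := `|\val x - \val y|.

Lemma cube_ballE (x : cube) e (y : cube) : ball x e y = (cube_dist x y < e).
Proof.
rewrite -[LHS]/(ball (\val x) e (\val y)).
by rewrite mx_norm_ball.
Qed.

Lemma cube_metric : compatible_metric cube_dist.
Proof.
split=> [x|x y|x y|y x z|x]; rewrite /cube_dist.
- by rewrite subrr normr0.
- by move=> /eqP; rewrite normr_eq0 subr_eq0 => /eqP /val_inj.
- exact: distrC.
- exact: ler_distD.
rewrite -[nbhs x]/(nbhs x) -(@nbhs_ballE R) /nbhs_ball; congr nbhs_ball_.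
by apply/funext => y; apply/funext => e; apply/seteqP; split=> z /=;
  rewrite cube_ballE.
Qed.

Lemma cube_dist_lt (x y : cube) e : 0 < e ->
  (forall c, `|\val x ord0 c - \val y ord0 c| < e) -> cube_dist x y < e.
Proof.
move=> e0 h; rewrite -cube_ballE.
rewrite -[ball _ _ _]/(ball (\val x) e (\val y)); split=> // i j.
by rewrite (ord1 i); exact: h.
Qed.

Lemma cube_coord_continuous c : continuous (fun x : cube => \val x ord0 c).
Proof.
move=> x; apply: (@continuous_comp _ _ _ (set_val : cube -> _)
  (fun y : 'rV[R]_D => y ord0 c)); first exact: initial_continuous.
exact: coord_continuous.
Qed.

(* The preimages of the vertices of the simplex under the usual
   correspondence between the cube and the simplex; no member meets two
   opposite faces of the cube. *)
Definition corner_cover (k : nat) : set cube :=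
  if k is i.+1 then [set x : cube | exists2 c : 'I_D, c = i :> nat & 0 < \val x ord0 c]
  else [set x : cube | forall c, \val x ord0 c < 1].

Lemma corner_cover_open k : open (corner_cover k).
Proof.
case: k => [|i] /=.
  rewrite openE => x xlt.
  apply: (@filter_forall _ _ (fun c (y : cube) => \val y ord0 c < 1) (nbhs x) _) => c.
  apply: (@cube_coord_continuous c x [set y | y < 1]).
  by apply: open_nbhs_nbhs; split; [exact: open_lt|exact: xlt].
have -> : [set x : cube | exists2 c : 'I_D, c = i :> nat & 0 < \val x ord0 c] =
  \bigcup_(c in [set c : 'I_D | c = i :> nat]) [set x : cube | 0 < \val x ord0 c].
  by apply/seteqP; split=> x [c ? ?]; exists c.
apply: bigcup_open => c _.
apply: (@open_comp _ _ (fun x : cube => \val x ord0 c) [set y | y > 0]);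
  last exact: open_gt.
by move=> x _; exact: cube_coord_continuous.
Qed.

(** Label a grid point by a corner set containing a member of [V] that contains its [r]-ball.
    Sperner gives a simplex of diameter below [r] with all [n.+2] labels; the corresponding members
    are distinct and all contain its lowest vertex. *)
Lemma cube_dim_gt : ~ covering_dim_le cube n.
Proof.
move=> /(_ [set A | exists2 k, (k <= D)%N & A = corner_cover k]) [|V [Vcov Vref Vcard]].
  split=> [_ [k _ ->]|]; first exact: corner_cover_open.
  apply/seteqP; split=> // x _.
  have [h|/existsNP[c /negP hc]] := pselect (forall c, \val x ord0 c < 1).
    by exists (corner_cover 0) => //; exists 0%N.
  exists (corner_cover c.+1); first by exists c.+1 => //; exact: ltn_ord.
  exists c => //; move: hc; rewrite -leNgt; apply: lt_le_trans; exact: ltr01.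
have [r r0 rP] := lebesgue_number cube_metric cube_compact Vcov.
have /choice[Bf BfP] (x : cube) : exists A, V A /\ forall y, cube_dist x y < r -> A y.
  by have [A VA Ar] := rP x; exists A.
have /choice[idx idxP] (A : set cube) : exists k, V A -> (k <= D)%N /\ A `<=` corner_cover k.
  have [/Vref[_ [k kD ->] Ak]|nVA] := pselect (V A); last by exists 0%N.
  by exists k.
have [m m_lt] := exp2V_lt r0.
pose M := (2 ^ m)%N.
have M0 : (0 < M)%N by rewrite expn_gt0.
have MR : 0 < M%:R :> R by rewrite ltr0n.
(* The truncation makes [pt] total; it changes nothing for coordinates up to [M]. *)
have ptP (w : {ffun 'I_D -> nat}) : cube (\row_c Num.min ((w c)%:R / M%:R) 1).
  move=> c /=; rewrite mxE ge_min lexx orbT andbT le_min ler01 andbT.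
  by rewrite divr_ge0.
pose pt w : cube := @exist _ (fun x => x \in cube) _ (mem_set (ptP w)).
have ptE w c : \val (pt w) ord0 c = Num.min ((w c)%:R / M%:R) 1 by rewrite /= mxE.
pose lab w := idx (Bf (pt w)).
have labP w : (lab w <= D)%N /\ corner_cover (lab w) (pt w).
  have [VB Bx] := BfP (pt w); have [? h] := idxP _ VB; split=> //; apply: h.
  by apply: Bx; rewrite /cube_dist subrr normr0.
have [w c lw|w c lw|v [s [vM full]]] := @sperner D M lab M0 (fun w => (labP w).1).
- have [_] := labP w; rewrite lw => /(_ c); rewrite ptE.
  by apply: contraTneq => ->; rewrite divff ?gt_eqF // minxx ltxx.
- have [_] := labP w; rewrite lw => -[c' /val_inj ->]; rewrite ptE.
  by rewrite lt_min lt0n => /andP[+ _]; apply: contraTneq => ->; rewrite mul0r ltxx.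
pose p0 := pt (vert v s 0).
have close (j : 'I_D.+1) : cube_dist (pt (vert v s j)) p0 < r.
  apply: cube_dist_lt => // c; rewrite !ptE !ffunE ltn0 addn0.
  apply: le_lt_trans m_lt.
  have e1 : (v c + (s c < j))%:R / M%:R <= (v c)%:R / M%:R + 2 ^- m :> R.
    rewrite natrD mulrDl lerD2l /M natrX ler_pdivrMr ?exprn_gt0 //.
    by rewrite mulVf ?expf_neq0 ?pnatr_eq0 // lern1 leq_b1.
  have e2 : (v c)%:R / M%:R <= (v c + (s c < j))%:R / M%:R :> R.
    by rewrite ler_pM2r ?invr_gt0 // ler_nat leq_addr.
  move: e1 e2; set a := _ / _; set b := _ / _; set e := 2 ^- m => e1 e2.
  have ee : 0 <= e by rewrite invr_ge0 exprn_ge0.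
  rewrite ler_norml /Num.min; do 2 case: ifP => /=; lra.
have := Vcard p0.
suff : `I_D.+1 #<= [set B | V B /\ B p0].
  by move=> h1 h2; have := card_le_trans h1 h2; rewrite card_le_II ltnn.
apply: card_le_trans (card_image_le idx _); apply: subset_card_le => i /= iD.
have [j jP] := full (Ordinal iD); exists (Bf (pt (vert v s j))); last exact: jP.
have [VB Bx] := BfP (pt (vert v s j)); split=> //; apply: Bx; exact: close.
Qed.

End Cube.

Lemma universal_infinite_dimensional (R : realType) (X : topologicalType) :
  compact_metrizable R X ->
  (forall K : topologicalType, compact_metrizable R K -> contains_copy X K) ->
  infinite_dimensional X.
Proof.
move=> [_ [d dX]] univ n dimX; apply: (@cube_dim_gt R n).
have cK := @cube_compact R n.
have [|f fE] := univ (@cube R n : topologicalType).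
  by split=> //; exists (@cube_dist R n); exact: cube_metric.
exact: covering_dim_le_embedding (cmetric_hausdorff dX) cK fE dimX.
Qed.

(** * Expansive actions of virtually cyclic groups *)

Lemma cmetric_continuous (R : realType) (X : topologicalType)
    (d : X -> X -> R) : compatible_metric d ->
  continuous (fun p : X * X => d p.1 p.2).
Proof.
move=> dX -[x y]; apply/(@cvgrPdist_lt _ R) => e e0.
have nx : nbhs x [set z | d x z < e / 2].
  by apply/(cmetric_nbhsP dX); exists (e / 2) => //; lra.
have ny : nbhs y [set z | d y z < e / 2].
  by apply/(cmetric_nbhsP dX); exists (e / 2) => //; lra.
exists ([set z | d x z < e / 2], [set z | d y z < e / 2]); first by split.
move=> [x' y'] /= [xx' yy']; rewrite ltr_norml.
have := cmetric_triangle dX x' x y; have := cmetric_triangle dX y' x' y.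
have := cmetric_triangle dX x x' y'; have := cmetric_triangle dX y x y'.
by rewrite (cmetric_sym dX x' x) (cmetric_sym dX y' y); lra.
Qed.

Lemma cmetric_continuous2 (R : realType) (X Y : topologicalType)
    (d : Y -> Y -> R) (f g : X -> Y) : compatible_metric d ->
  continuous f -> continuous g -> continuous (fun x => d (f x) (g x)).
Proof.
move=> dY cf cg x.
apply: (@continuous_comp _ _ _ (fun x => (f x, g x)) (fun p => d p.1 p.2)).
  by apply: cvg_pair; [exact: cf|exact: cg].
exact: cmetric_continuous.
Qed.

Lemma card_le_seq (T : eqType) (l : seq T) :
  [set x | x \in l] #<= `I_(size l).
Proof.
case: l => [|x0 l].
  by rewrite (_ : [set x | x \in [::]] = set0) ?card_ge0 //; apply/seteqP; split.
apply: card_le_trans (card_image_le (nth x0 (x0 :: l)) _).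
apply: subset_card_le => x /= xl; exists (index x (x0 :: l)).
  by rewrite -[(size l).+1]/(size (x0 :: l)) index_mem.
exact: nth_index.
Qed.

Lemma unif_continuous_seq (R : realType) (X Y : topologicalType) (I : eqType)
    (d : X -> X -> R) (dY : Y -> Y -> R) (f : I -> X -> Y) (s : seq I) :
  compatible_metric d -> compact [set: X] -> compatible_metric dY ->
  (forall i, continuous (f i)) ->
  forall e, 0 < e -> exists2 r, 0 < r & forall i x y, i \in s ->
    d x y < r -> dY (f i x) (f i y) < e.
Proof.
move=> dX cX dYP cf e e0; elim: s => [|i s [r r0 rP]]; first by exists 1.
have [r' r'0 r'P] := cmetric_unif_continuous dX cX dYP (cf i) e0.
exists (Num.min r r'); first by rewrite lt_min r0.
move=> j x y; rewrite inE lt_min => /orP[/eqP->|js] /andP[xr xr'].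
  exact: r'P.
exact: rP.
Qed.

(** * Mañé's theorem for expansive homeomorphisms *)

Section Mane.
Variables (R : realType) (X : topologicalType) (d : X -> X -> R).
Hypotheses (dX : compatible_metric d) (cX : compact [set: X]).
Variable F : int -> X -> X.
Hypotheses (FD : forall i j x, F (i + j) x = F i (F j x)).
Hypothesis Fcont : forall i, continuous (F i).
Variable e : R.
Hypothesis e_gt0 : 0 < e.
Hypothesis Fexp : forall x y, x <> y -> exists k, 2 * e < d (F k x) (F k y).

(** The pairs at distance at least [r] form a compact set, covered by the open sets of pairs
    separated at time [k]; finitely many times suffice. *)
Lemma unif_expansive r : 0 < r -> exists N : nat, forall x y,
  (forall k : int, `|k| <= N%:Z -> d (F k x) (F k y) <= 2 * e) -> d x y < r.
Proof.
move=> r0.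
have cd : continuous (fun p : X * X => d p.1 p.2) by exact: cmetric_continuous.
have cA : compact [set p : X * X | r <= d p.1 p.2].
  have cXX : compact [set: X * X] by rewrite -setXTT; exact: compact_setX.
  apply: (subclosed_compact _ cXX) => //.
  by apply: (@closed_comp _ _ (fun p => d p.1 p.2) [set y | r <= y]);
    [move=> *; exact: cd|exact: closed_ge].
have [k|p|s sP] := @compact_finite_subcover _ _ int
    (fun k : int => [set p : X * X | 2 * e < d (F k p.1) (F k p.2)]) cA.
- apply: (@open_comp _ _ (fun p : X * X => d (F k p.1) (F k p.2))
    [set y | 2 * e < y]); last exact: open_gt.
  move=> p _; apply: (cmetric_continuous2 dX) => q.
    apply: (@continuous_comp _ _ _ fst (F k)); first exact: cvg_fst.
    exact: Fcont.
  apply: (@continuous_comp _ _ _ snd (F k)); first exact: cvg_snd.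
  exact: Fcont.
- move=> /= rp; apply: Fexp => e12; move: rp.
  by rewrite e12 (cmetric_refl dX) leNgt r0.
exists (\max_(k <- s) `|k|%N) => x y small; rewrite ltNge; apply/negP => rxy.
have [k ks /=] := sP (x, y) rxy; rewrite ltNge small //.
by rewrite -abszE lez_nat; apply: leq_bigmax_seq.
Qed.

(** A distance of at least [e] at time [k] forces one above [2 * e] within [N] steps of [k]. This
    must happen outside the window, so [k] lies within [N] of an end, where uniform continuity
    carries the closeness at the end over to [k]. *)
Lemma endpoint_control : exists2 r, 0 < r & forall (n : nat) x y,
  d (F (- n%:Z) x) (F (- n%:Z) y) < r -> d (F n x) (F n y) < r ->
  (forall k : int, `|k| <= n%:Z -> d (F k x) (F k y) <= 2 * e) ->
  forall k : int, `|k| <= n%:Z -> d (F k x) (F k y) < e.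
Proof.
have [N NP] := unif_expansive e_gt0.
pose s := [seq (i%:Z - N%:Z)%R | i <- iota 0 (2 * N).+1].
have [r r0 rP] := unif_continuous_seq s dX cX dX Fcont e_gt0.
have rs (k : int) x y : `|k| <= N%:Z -> d x y < r -> d (F k x) (F k y) < e.
  move=> kN; apply: rP; apply/mapP; exists (absz (k + N%:Z)); last by lia.
  by rewrite mem_iota; lia.
exists r => // n x y xn yn small k kn; rewrite ltNge; apply/negP => ek.
have [j jP] : exists j : int, ~ (`|j| <= N%:Z -> d (F (j + k) x) (F (j + k) y) <= 2 * e).
  apply/existsNP => h; move: ek; rewrite leNgt NP // => j /h.
  by rewrite !FD.
have jN : `|j| <= N%:Z by apply: contrapT => nj; exact: jP.
have njk : ~ `|j + k| <= n%:Z by move=> /small h; exact: jP.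
move: ek; apply/negP; rewrite -ltNge.
have [jk|jk] := leP 0 (j + k).
  by rewrite -(subrK n%:Z k) !(FD (k - n%:Z)) rs //; lia.
by rewrite -(addrK n%:Z k) !(FD (k + n%:Z)) rs //; lia.
Qed.

(* Points of [f^n A `&` f^-n B], for small balls A and B, are either close
   or far apart along [-n, n], by [endpoint_control]; hence closeness is an
   equivalence relation there, and its classes, of small diameter for n large,
   form a cover of multiplicity at most the square of the number of balls. *)
Lemma mane : exists n, covering_dim_le X n.
Proof.
have [r r0 rP] := endpoint_control.
have r2 : 0 < r / 2 by lra.
have [s sP] := cmetric_totally_bounded dX cX r2.
exists (size s * size s)%N => U Ucov.
have [l l0 lP] := lebesgue_number dX cX Ucov.
have [n nP] := unif_expansive l0.
pose W a b := [set x | d a (F (- n%:Z) x) < r / 2 /\ d b (F n x) < r / 2].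
pose cls a b x : set X := [set y | W a b y /\
  forall k : int, `|k| <= n%:Z -> d (F k x) (F k y) < e].
have WP a b x y : W a b x -> W a b y ->
    (forall k : int, `|k| <= n%:Z -> d (F k x) (F k y) <= 2 * e) ->
    forall k : int, `|k| <= n%:Z -> d (F k x) (F k y) < e.
  move=> [ax bx] [ay byy]; apply: rP.
    have := cmetric_triangle dX a (F (- n%:Z) x) (F (- n%:Z) y).
    by rewrite (cmetric_sym dX _ a); lra.
  have := cmetric_triangle dX b (F n x) (F n y).
  by rewrite (cmetric_sym dX _ b); lra.
have clsE a b x z : W a b z -> cls a b z x -> cls a b z = cls a b x.
  move=> Wz [Wx zx]; apply/seteqP; split=> y [Wy h]; split=> //.
    apply: (WP a b) => // k kn.
    have := cmetric_triangle dX (F k z) (F k x) (F k y).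
    by rewrite (cmetric_sym dX (F k x) (F k z)); have := h k kn; have := zx k kn; lra.
  apply: (WP a b) => // k kn.
  have := cmetric_triangle dX (F k x) (F k z) (F k y).
  by have := h k kn; have := zx k kn; lra.
have openF k c t : open [set y | d c (F k y) < t].
  apply: (@open_comp _ _ (F k) [set y | d c y < t]).
    by move=> *; exact: Fcont.
  exact: cmetric_ball_open.
exists [set B | exists a b x, [/\ a \in s, b \in s, W a b x & B = cls a b x]]; split.
- split=> [_ [a [b [x [_ _ _ ->]]]]|].
    have -> : cls a b x = W a b `&` [set y | forall i : 'I_(2 * n).+1,
        d (F (i%:Z - n%:Z) x) (F (i%:Z - n%:Z) y) < e].
      apply/seteqP; split=> y [Wy h]; split=> //.
        by move=> i; apply: h; have := ltn_ord i; lia.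
      move=> k kn; have kn' : (absz (k + n%:Z)%R < (2 * n).+1)%N by lia.
      by have := h (Ordinal kn'); rewrite /= (_ : _ - _ = k) //; lia.
    apply: openI; first exact: openI (openF _ _ _) (openF _ _ _).
    rewrite openE => y yP; apply: (@filter_forall X _ (fun (i : 'I_(2 * n).+1) z =>
      d (F (i%:Z - n%:Z) x) (F (i%:Z - n%:Z) z) < e) (nbhs y) _).
    by move=> i; apply: open_nbhs_nbhs; split; [exact: openF|exact: yP].
  apply/seteqP; split=> // x _.
  have [a sa ax] := sP (F (- n%:Z) x); have [b sb bx] := sP (F n x).
  exists (cls a b x); first by exists a, b, x.
  by split=> // k _; rewrite (cmetric_refl dX).
- move=> _ [a [b [x [_ _ _ ->]]]]; have [A UA xA] := lP x.
  exists A => // y [_ h]; apply: xA; apply: nP => k /h; have := e_gt0; lra.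
move=> x; apply: (@card_le_trans _ _ _ `I_(size s * size s)); last first.
  by rewrite card_le_II.
rewrite -(size_allpairs (fun a b => cls a b x)); apply: card_le_trans (card_le_seq _).
apply: subset_card_le => _ [[a [b [z [sa sb Wz ->]]]] zx] /=.
by apply/allpairsP; exists (a, b); split=> //=; exact: clsE.
Qed.

End Mane.

(** * Integer powers and the reduction to a cyclic group *)

Section IntPowers.
Variable G : groupType.
Implicit Types g : G.

Definition zpow g (k : int) : G :=
  match k with Posz n => (g ^+ n)%g | Negz n => (g ^- n.+1)%g end.

Lemma zpow1D g k : zpow g (1 + k) = (g * zpow g k)%g.
Proof.
case: k => [n|[|n]].
- have -> : 1 + n%:Z = n.+1%:Z by lia.
  by rewrite /= expgS.
- have -> : 1 + Negz 0 = 0 by lia.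
  by rewrite /= expg1 mulgV.
have -> : 1 + Negz n.+1 = Negz n by lia.
by rewrite /= [(g ^+ n.+2)%g]expgSr invgM mulKVg.
Qed.

Lemma zpowD g j k : zpow g (j + k) = (zpow g j * zpow g k)%g.
Proof.
have pos n k' : zpow g (n%:Z + k') = (g ^+ n * zpow g k')%g.
  elim: n => [|n IHn]; first by rewrite add0r expg0 mul1g.
  by rewrite -addn1 addnC PoszD -addrA zpow1D IHn expgS mulgA.
case: j => n; first exact: pos.
rewrite -[LHS](mulKg (g ^+ n.+1)%g) -pos; congr (_ * zpow _ _)%g; lia.
Qed.

Lemma generated_zpow g : generated_subgroup [set g] `<=` range (zpow g).
Proof.
move=> x; apply => /=; split; last by move=> _ ->; exists 1.
split=> [|y z]; first by apply/mem_set; exists 0.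
move=> /set_mem[j _ <-] /set_mem[k _ <-]; apply/mem_set; exists (j - k) => //.
rewrite zpowD; congr (_ * _)%g; apply: (@mulgI _ (zpow g k)).
by rewrite -zpowD subrr mulgV.
Qed.

Lemma generated_subgroup1 (S : set G) : generated_subgroup S 1%g.
Proof. by move=> H [[/set_mem H1 _] _]. Qed.

Lemma finite_index_reps (H : set G) : H 1%g -> finite_index H ->
  exists s : seq G, forall x, exists2 c, c \in s & exists2 h, H h & x = (c * h)%g.
Proof.
move=> H1 /finite_seqP[l lP].
have /choice[c cP] (C : set G) : exists c, (exists x, C = [set (x * h)%g | h in H]) ->
    C = [set (c * h)%g | h in H].
  have [[x ->]|nC] := pselect (exists x, C = [set (x * h)%g | h in H]).
    by exists x.
  by exists 1%g.
exists [seq c C | C <- l] => x; pose C := [set (x * h)%g | h in H].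
have Cl : C \in l.
  have : range (fun y : G => [set (y * h)%g | h in H]) C by exists x.
  by rewrite lP.
have : C (x * 1)%g by exists 1%g.
rewrite mulg1 (cP C); last by exists x.
by move=> [h Hh <-]; exists (c C); [apply/mapP; exists C|exists h].
Qed.

End IntPowers.

Lemma expansive_virtually_cyclic (R : realType) (G : groupType)
    (X : dynsys R G) :
  virtually_cyclic G -> expansive X -> exists n, covering_dim_le X n.
Proof.
move=> [g fin] [d dX [e e0 eP]].
have [s sP] := finite_index_reps (@generated_subgroup1 G _) fin.
have [cX _] := dynsys_compact_metrizable X.
have [r r0 rP] := unif_continuous_seq s dX cX dX
  (fun h => @gact_continuous G X h) e0.
(* If [h = c * g ^ k] separates two points by more than [e], the uniform continuity of the finitely
   many [c] leaves a distance of at least [r] at time [k]. Mañé's hypothesis wants strictly more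
   than twice the constant, hence [r / 3]. *)
refine (@mane R X d dX cX (fun k => gact (zpow g k)) _ _ (r / 3) _ _).
- by move=> j k x; rewrite zpowD gactM.
- by move=> k; exact: gact_continuous.
- by lra.
move=> x y /eP[h hxy]; have [c cs [h' /generated_zpow[k _ <-] hE]] := sP h.
exists k; suff : r <= d (gact (zpow g k) x) (gact (zpow g k) y) by lra.
rewrite leNgt; apply/negP => /(rP c _ _ cs).
by rewrite -!gactM -hE => /(lt_trans hxy); rewrite ltxx.
Qed.

(** * Subshifts *)

Section FullShift.
Variables (G : groupType) (S : finType).

Lemma full_shift_compact : compact [set: full_shift G S].
Proof.
have := @tychonoff G (fun=> discrete_topology S) (fun=> setT)
  (fun=> @finite_compact (discrete_topology S) setT (@finite_finset S setT)).
by congr compact; apply/seteqP; split.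
Qed.

Lemma nbhs_full_shift (x : full_shift G S) (h : G) :
  nbhs x [set y | y h = x h].
Proof.
apply: (@proj_continuous G (fun=> discrete_topology S) h x
  [set s | s = x h]).
exact: (@discrete_set1 (discrete_topology S) (x h)).
Qed.

Lemma full_shift_continuous (T : topologicalType) (f : T -> full_shift G S) :
  (forall x h, nbhs x [set y | f y h = f x h]) -> continuous f.
Proof.
move=> fP x; have FF : Filter (f y @[y --> x]) by exact: (@fmap_filter _ _ _ _ (nbhs_filter x)).
apply/cvg_sup => h U [/= V [[B oB <-] Bx] BU].
apply: (filterS BU); apply: filterS (fP x h) => y /= yh.
by rewrite /preimage /= -[f y h]/(f y h) yh.
Qed.

End FullShift.

Section SubshiftQuotientPi.
Variables (G : groupType) (S : finType) (Y : set (full_shift G S)).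
Variable Z : set (full_shift G (S * S)%type).
Hypotheses (subY : is_subshift Y) (subZ : is_subshift Z).
Hypothesis eqvZ : is_equivalence_on Y Z.

Local Notation Q := (quotient_topology {eq_quot (subshift_equiv subY eqvZ)}).

Definition subshift_pi (y : Y) : subshift_quotient subY subZ eqvZ := \pi_Q y.

Lemma subshift_pi_continuous : continuous subshift_pi.
Proof. exact: pi_continuous. Qed.

Lemma subshift_pi_surj q : exists y, subshift_pi y = q.
Proof. by exists (repr (q : Q)); rewrite /subshift_pi reprK. Qed.

Lemma subshift_piP y y' :
  subshift_pi y = subshift_pi y' <-> Z (pair_config (\val y) (\val y')).
Proof.
split=> [/eqmodP /asboolP //|h]; apply/eqmodP; exact/asboolP.
Qed.

Lemma subshift_pi_act g (y : restriction subY.2) :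
  subshift_pi (gact g y) = gact g (subshift_pi y).
Proof. exact/esym/quot_act_pi/subshift_equiv_invariant. Qed.

Lemma subshift_compact : compact [set: Y].
Proof.
apply: compact_set_type; by apply: (subclosed_compact subY.1 (@full_shift_compact G S)).
Qed.

Lemma subshift_quotient_compact :
  compact [set: subshift_quotient subY subZ eqvZ].
Proof.
have -> : [set: subshift_quotient subY subZ eqvZ] = subshift_pi @` setT.
  by apply/seteqP; split=> // q _; have [y yq] := subshift_pi_surj q; exists y.
apply: continuous_compact; last exact: subshift_compact.
by apply: continuous_subspaceT; exact: subshift_pi_continuous.
Qed.

End SubshiftQuotientPi.

Lemma pair_config_continuous (G : groupType) (S : finType)
    (T : topologicalType) (f g : T -> full_shift G S) :
  continuous f -> continuous g ->
  continuous (fun x => pair_config (f x) (g x)).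
Proof.
move=> cf cg; apply: full_shift_continuous => x h.
have fh : nbhs x [set y | f y h = f x h] := cf x _ (nbhs_full_shift (f x) h).
have gh : nbhs x [set y | g y h = g x h] := cg x _ (nbhs_full_shift (g x) h).
by apply: (filterS _ (filterI fh gh)) => y [/= fy gy]; rewrite /pair_config fy gy.
Qed.

(* The distance between the images of the two points is bounded below on the
   compact set of pairs lying in the clopen set of forbidden patterns. *)
Lemma subshift_over_SFT_expansive (R : realType) (G : groupType)
    (X : dynsys R G) : subshift_over_SFT X -> expansive X.
Proof.
move=> [S [Y [Z [subY [sftZ [eqvZ [f [f' [[fK f'K] cf cf' fG]]]]]]]]].
have [_ [C clC CP]] := sftZ.
have [cX [d dX]] := dynsys_compact_metrizable X.
pose h (y : Y) : X := f' (subshift_pi subY sftZ.1 eqvZ y).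
have ch : continuous h.
  move=> y; apply: continuous_comp; first exact: subshift_pi_continuous.
  exact: cf'.
pose A := [set p : Y * Y | C (pair_config (\val p.1) (\val p.2))].
have cval : continuous (fun y : Y => \val y : full_shift G S).
  exact: initial_continuous.
have cA : compact A.
  have cYY : compact [set: Y * Y].
    by rewrite -setXTT; apply: compact_setX; exact: subshift_compact.
  apply: (subclosed_compact _ cYY) => //.
  apply: (@closed_comp _ _ (fun p : Y * Y => pair_config (\val p.1) (\val p.2)) C);
    last exact: clC.2.
  move=> p _; apply: pair_config_continuous => q.
    by apply: (@continuous_comp _ _ _ fst); [exact: cvg_fst|exact: cval].
  by apply: (@continuous_comp _ _ _ snd); [exact: cvg_snd|exact: cval].
have [n|p Ap|s sP] := @compact_finite_subcover _ _ nat
    (fun n => [set p : Y * Y | 2 ^- n < d (h p.1) (h p.2)]) cA.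
- apply: (@open_comp _ _ (fun p : Y * Y => d (h p.1) (h p.2))
    [set y | 2 ^- n < y]); last exact: open_gt.
  move=> p _; apply: (cmetric_continuous2 dX) => q.
    by apply: (@continuous_comp _ _ _ fst); [exact: cvg_fst|exact: ch].
  by apply: (@continuous_comp _ _ _ snd); [exact: cvg_snd|exact: ch].
- apply: exp2V_lt; apply: (cmetric_gt0 dX) => /(can_inj f'K).
  by move=> /subshift_piP /CP /(_ 1%g); rewrite gact1.
exists d => //; exists (2 ^- (\max_(n <- s) n)); first by rewrite invr_gt0 exprn_gt0.
move=> x x' xx'.
have [y yx] := subshift_pi_surj (f x).
have [y' yx'] := subshift_pi_surj (f x').
have hx : h y = x by rewrite /h yx fK.
have hx' : h y' = x' by rewrite /h yx' fK.
have hG g (u : restriction subY.2) : h (gact g u) = gact g (h u).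
  by apply: (can_inj fK); rewrite fG /h !f'K subshift_pi_act.
have [g gC] : exists g, C (gact g (pair_config (\val y) (\val y'))).
  apply: contrapT => nC; apply: xx'; rewrite -hx -hx' /h; congr f'.
  by apply/subshift_piP/CP => g gC; apply: nC; exists g.
have [n ns nd] := sP (@gact G (restriction subY.2) g y, @gact G (restriction subY.2) g y') gC.
exists g; rewrite -hx -hx' -!hG; move: nd => /=; apply: le_lt_trans.
rewrite lef_pV2 ?posrE ?exprn_gt0 // ler_eXn2l ?ltr1n //.
exact: leq_bigmax_seq.
Qed.

(** * Growth of infinite torsion groups *)

Lemma dependent_sequence (T : Type) (P : seq T -> T -> Prop) :
  (forall l, exists x, P l x) ->
  exists a : nat -> T, forall n, P [seq a i | i <- iota 0 n] (a n).
Proof.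
move=> /choice[nxt nxtP].
pose pref := fix pref n := if n is k.+1 then rcons (pref k) (nxt (pref k)) else [::].
exists (fun n => nxt (pref n)) => n.
suff <- : pref n = [seq nxt (pref i) | i <- iota 0 n] by exact: nxtP.
elim: n => [//|n IHn].
by rewrite -[in RHS]addn1 iotaD map_cat -IHn cats1 add0n.
Qed.

Section Words.
Variables (G : groupType) (k : nat) (gen : 'I_k -> G).
Local Notation word := (seq 'I_k).
Implicit Types u v w : word.

Definition wval w : G := foldr (fun a x => gen a * x)%g 1%g w.

Lemma wval_cat u v : wval (u ++ v) = (wval u * wval v)%g.
Proof. by elim: u => [|a u IHu] /=; rewrite ?mul1g // IHu mulgA. Qed.

Lemma wval_flatten n u : wval (flatten (nseq n u)) = (wval u ^+ n)%g.
Proof. by elim: n => [|n IHn] //=; rewrite wval_cat IHn expgS. Qed.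

(* Bijective numeration: minimality of [code] is minimality for the shortlex
   order. *)
Definition code w : nat := foldl (fun c (a : 'I_k) => c * k.+1 + a.+1)%N 0%N w.

Lemma code_rcons w a : code (rcons w a) = (code w * k.+1 + a.+1)%N.
Proof. by rewrite /code foldl_rcons. Qed.

Lemma code_cat u v : code (u ++ v) = (code u * k.+1 ^ size v + code v)%N.
Proof.
elim/last_ind: v => [|v a IHv]; first by rewrite cats0 muln1 addn0.
by rewrite -rcons_cat !code_rcons IHv size_rcons expnSr; ring.
Qed.

(** The digits are 1, ..., k in base [k.+1]. With [code_ge], this places the codes of different
    lengths in disjoint intervals, ordered by length. *)
Lemma code_lt u : (code u < k.+1 ^ size u)%N.
Proof.
elim/last_ind: u => [//|u a IHu]; rewrite code_rcons size_rcons expnSr.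
by have := ltn_ord a; move: IHu; nia.
Qed.

Lemma code_ge a u : (k.+1 ^ size u <= code (a :: u))%N.
Proof. by rewrite -cat1s code_cat /code /=; nia. Qed.

Lemma code_lt_size u v : (size u < size v)%N -> (code u < code v)%N.
Proof.
case: v => // a v; rewrite ltnS => uv; apply: leq_trans (code_ge a v).
by apply: leq_trans (code_lt u) _; rewrite leq_pexp2l.
Qed.

Lemma code_inj u v : code u = code v -> u = v.
Proof.
move=> uv; have [uv'|vu|] := ltngtP (size u) (size v).
- by have := code_lt_size uv'; rewrite uv ltnn.
- by have := code_lt_size vu; rewrite uv ltnn.
elim/last_ind: u v uv => [|u a IHu] v uv; first by case: v uv.
case/lastP: v uv => [|v b]; rewrite ?size_rcons // !code_rcons => e [es].
have eab : a = b :> nat.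
  have : ((code u * k.+1 + a.+1) %% k.+1 = (code v * k.+1 + b.+1) %% k.+1)%N by rewrite e.
  by rewrite !modnMDl !modn_small ?ltnS // => -[].
congr rcons; last exact/val_inj.
by apply: IHu => //; move: e; rewrite eab; nia.
Qed.

Definition red w := forall w', wval w' = wval w -> (code w <= code w')%N.

Lemma red_uniq u v : red u -> red v -> wval u = wval v -> u = v.
Proof.
move=> ru rv e; apply/code_inj/anti_leq.
by rewrite (ru v (esym e)) (rv u e).
Qed.

(** Replacing [v] by a word of the same value and smaller code, hence no longer, would lower the
    code of the whole word. *)
Lemma red_infix u v w : red (u ++ v ++ w) -> red v.
Proof.
move=> r v' e; have := r (u ++ v' ++ w); rewrite !wval_cat e => /(_ erefl).
rewrite !code_cat !size_cat !expnD; have [|//] := ltnP (code v') (code v) => lt.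
have sz : (k.+1 ^ size v' <= k.+1 ^ size v)%N.
  rewrite leq_pexp2l // leqNgt; apply/negP => /code_lt_size; lia.
have := expn_gt0 k.+1 (size w); rewrite /= => p0.
have e1 : (code u * (k.+1 ^ size v' * k.+1 ^ size w) <= code u * (k.+1 ^ size v * k.+1 ^ size w))%N.
  by rewrite leq_mul2l leq_mul2r sz !orbT.
have e2 : (code v' * k.+1 ^ size w < code v * k.+1 ^ size w)%N.
  by rewrite ltn_mul2r p0.
lia.
Qed.

Lemma red_exists w : exists2 w', wval w' = wval w & red w'.
Proof.
have ex : exists n, `[< exists w', wval w' = wval w /\ code w' = n >].
  by exists (code w); apply/asboolP; exists w.
case: (ex_minnP ex) => n /asboolP[w' [vw' <-]] minw; exists w' => // u.
by rewrite vw' => vu; apply: minw; apply/asboolP; exists u.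
Qed.

Hypothesis gen_onto : forall g, exists w, wval w = g.
Hypothesis infG : infinite_set [set: G].
Hypothesis torsion : forall g : G, exists2 n, (0 < n)%N & (g ^+ n = 1)%g.

Lemma red_size n : exists2 w, size w = n & red w.
Proof.
have [w rw wn] : exists2 w, red w & (n <= size w)%N.
  apply: contrapT => none; apply: infG.
  have fin : finite_set [set g | exists2 w, (size w < n)%N & wval w = g].
    have -> : [set g | exists2 w, (size w < n)%N & wval w = g] =
        (fun t : {i : 'I_n & i.-tuple 'I_k} => wval (tagged t)) @` setT.
      apply/seteqP; split=> [g [w wn <-]|_ [t _ <-]].
        by exists (Tagged (fun i : 'I_n => i.-tuple 'I_k) (in_tuple w : (Ordinal wn).-tuple _)).
      by exists (tagged t) => //; rewrite size_tuple; apply: ltn_ord.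
    by apply: finite_image; exact: finite_finset.
  apply: sub_finite_set fin => g _ /=.
  have [w wg] := gen_onto g; have [w' w'w rw'] := red_exists w.
  exists w'; last by rewrite w'w.
  by rewrite ltnNge; apply/negP => nw'; apply: none; exists w'.
exists (take n w); first by rewrite size_takel.
by apply: (@red_infix [::] _ (drop n w)); rewrite /= cat_take_drop.
Qed.

Definition extendable w := forall n, exists2 u, size u = n & red (w ++ u).

Lemma extendable0 : extendable [::].
Proof. by move=> n; have [w] := red_size n; exists w. Qed.

(** König's lemma: if each letter [a] failed at some length [N a], then [w] would fail one letter
    beyond the maximum of these lengths. *)
Lemma extendable_rcons w : extendable w -> exists a, extendable (rcons w a).
Proof.
move=> ew; apply: contrapT => none.
have /choice[N NP] a : exists n, forall u, size u = n -> ~ red (rcons w a ++ u).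
  apply: contrapT => h; apply: none; exists a => n; apply: contrapT => h'.
  by apply: h; exists n => u un ru; apply: h'; exists u.
have [u] := ew (\max_a N a).+1.
case: u => // a u [su]; rewrite -cat_rcons => r.
apply: (NP a (take (N a) u)).
  by rewrite size_takel // su; exact: leq_bigmax.
by apply: (@red_infix [::] _ (drop (N a) u)); rewrite /= -catA cat_take_drop.
Qed.

Lemma infinite_red : exists om : nat -> 'I_k, forall i n,
  red [seq om j | j <- iota i n].
Proof.
have [a0 _] := extendable_rcons extendable0.
have [|om omP] := @dependent_sequence 'I_k
    (fun w a => extendable w -> extendable (rcons w a)).
  move=> w; have [/extendable_rcons[a ea]|ne] := pselect (extendable w).
    by exists a.
  by exists a0.
have ext_pref n : extendable [seq om j | j <- iota 0 n].
  elim: n => [|n IHn]; first exact: extendable0.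
  by rewrite -addn1 iotaD map_cat cats1 add0n; exact: omP.
exists om => i n; have [u _] := ext_pref (i + n)%N 0%N.
by rewrite iotaD map_cat -catA; exact: red_infix.
Qed.

(* Morse-Hedlund: otherwise the infinite shortlex word [om] would be eventually
   periodic, and its period would give an element of infinite order. *)
Lemma sphere_growth n : exists2 s : seq G, uniq s /\ size s = n.+1 &
  forall g, g \in s -> exists w, [/\ red w, size w = n & wval w = g].
Proof.
have [om omP] := infinite_red.
have szfac i m : size [seq om j | j <- iota i m] == m by rewrite size_map size_iota.
pose fac i m : m.-tuple 'I_k := Tuple (szfac i m).
have redfac i m : red (fac i m) by exact: omP.
have facS i m : fac i m.+1 = om i :: fac i.+1 m :> seq _ by [].
have facSr i m : fac i m.+1 = rcons (fac i m) (om (i + m)%N) :> seq _.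
  by rewrite /= -[LHS]/([seq om j | j <- iota i m.+1]) -addn1 iotaD map_cat cats1.
(* The factors of length [m] of the infinite word; their number will be shown to increase strictly
   with [m]. *)
pose F m : {set m.-tuple 'I_k} := [set t | `[< exists i, fac i m = t >]]%SET.
have memF i m : fac i m \in F m by rewrite inE; apply/asboolP; exists i.
have FP m t : t \in F m -> exists i, fac i m = t by rewrite inE => /asboolP.
have step m : (#|F m| < #|F m.+1|)%N.
  rewrite ltnNge; apply/negP => le.
  (* Dropping the last letter maps factors onto factors. Without growth it is injective, so that
     each factor of length [m] determines the letter that follows it. *)
  pose f (t : m.+1.-tuple 'I_k) : m.-tuple 'I_k := [tuple of belast (thead t) (behead t)].
  have fE i : f (fac i m.+1) = fac i m.
    apply/val_inj => /=; have := facSr i m; rewrite facS lastI.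
    by move=> /rcons_inj[].
  have f_inj : {in F m.+1 &, injective f}.
    apply/imset_injP; rewrite eqn_leq leq_imset_card (leq_trans le) //.
    apply/subset_leq_card/fintype.subsetP => t /FP[i <-].
    by rewrite -fE imset_f ?memF.
  have fac_next i j : fac i m = fac j m -> fac i m.+1 = fac j m.+1.
    by move=> e; apply: f_inj; rewrite ?memF ?fE.
  have [i [j [ij eij]]] : exists i j, (i < j)%N /\ fac i m = fac j m.
    apply: contrapT => none.
    have inj : injective (fun i : 'I_(#|{: m.-tuple 'I_k}|.+1) => fac i m).
      move=> i j e; apply/val_inj; have [ij|ji|//] := ltngtP i j.
        by case: none; exists i, j.
      by case: none; exists j, i.
    by have := leq_card _ inj; rewrite card_ord ltnn.
  have shift t : fac (i + t)%N m = fac (j + t)%N m.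
    elim: t => [|t IHt]; first by rewrite !addn0.
    apply/val_inj; have := congr1 val (fac_next _ _ IHt).
    by rewrite !addnS => -[].
  have om_per x : (i + m <= x)%N -> om (j - i + x)%N = om x.
    move=> ix; set t := (x - m - i)%N; have := facSr (i + t)%N m.
    rewrite (fac_next _ _ (shift t)) facSr => /rcons_inj[_].
    by rewrite (_ : i + t + m = x)%N 1?(_ : j + t + m = j - i + x)%N //; lia.
  (* All powers of the period [v] are factors of [om], hence reduced; a power of value 1 would have
     to be the empty word. *)
  pose v := [seq om x | x <- iota (i + m) (j - i)].
  have powv q : [seq om x | x <- iota (i + m) (q * (j - i))] = flatten (nseq q v).
    elim: q => [//|q IHq]; rewrite mulSn iotaD map_cat [RHS]/= -IHq; congr (_ ++ _).
    rewrite addnC iotaDl -map_comp; apply/eq_in_map => x; rewrite mem_iota => /andP[ix _].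
    exact: om_per.
  have [q q0 vq] := torsion (wval v).
  have := omP (i + m)%N (q * (j - i))%N [::].
  rewrite powv wval_flatten vq => /(_ erefl); rewrite leqNgt code_lt_size //.
  by rewrite -powv size_map size_iota muln_gt0 q0 subn_gt0.
have cardF : (n < #|F n|)%N.
  elim: (n) => [|m IHm]; last exact: leq_ltn_trans IHm (step m).
  by apply/card_gt0P; exists (fac 0%N 0%N); exact: memF.
exists (take n.+1 [seq wval (tval t) | t <- enum (F n)]).
  split; last by rewrite size_takel // size_map -cardE.
  apply: take_uniq; rewrite map_inj_in_uniq ?enum_uniq // => t u.
  rewrite !mem_enum => /FP[i <-] /FP[j <-] e.
  by apply/val_inj; apply: red_uniq e; exact: redfac.
move=> g /mem_take/mapP[t]; rewrite mem_enum => /FP[i <-] ->.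
by exists (fac i n); split=> //; rewrite size_tuple.
Qed.

(** Sums the spheres of radii 0 to [r]. They are disjoint since the value of a reduced word
    determines the word, and so its length. *)
Lemma ball_growth r : exists2 s : seq G, uniq s /\ ((r.+1 * r.+2)%N <= 2 * size s)%N &
  forall g, g \in s -> exists w, [/\ red w, (size w <= r)%N & wval w = g].
Proof.
elim: r => [|r [s [us ss] sP]].
  have [s [us ss] sP] := sphere_growth 0; exists s; first by rewrite ss.
  by move=> g /sP[w [rw sw wg]]; exists w; rewrite sw.
have [t [ut st] tP] := sphere_growth r.+1; exists (s ++ t).
  rewrite cat_uniq us ut andbT size_cat st; split; last by lia.
  apply/hasPn => g /tP[w [rw sw wg]]; apply/negP => /= /sP[w' [rw' sw' w'g]].
  by move: sw; rewrite (red_uniq rw rw') ?wg //; lia.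
move=> g; rewrite mem_cat => /orP[/sP|/tP] [w [rw sw wg]]; exists w; split=> //.
  exact: leqW.
by rewrite sw.
Qed.

End Words.

(** * Isoperimetry in infinite torsion groups *)

Section Isoperimetry.
Variables (G : groupType) (m : nat) (sg : 'I_m -> G).
Implicit Types (F : seq G) (g : G).

Definition nbh F : seq G := undup [seq (sg a * x)%g | a <- enum 'I_m, x <- F].

Lemma nbhP F y :
  reflect (exists a x, x \in F /\ y = (sg a * x)%g) (y \in nbh F).
Proof.
rewrite mem_undup; apply: (iffP allpairsP) => [[[a x] /= [_ xF ->]]|[a [x [xF ->]]]].
  by exists a, x.
by exists (a, x); rewrite /= mem_enum.
Qed.

Definition bdry F : seq G := [seq y <- nbh F | y \notin F].

Definition moved g F : nat := count (fun x => (g * x)%g \notin F) F.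

Lemma count_translate g F (P : pred G) : uniq F ->
  (count (fun x => ((g * x)%g \in F) && P (g * x)%g) F <= count P F)%N.
Proof.
move=> uF; rewrite -!size_filter -(size_map (fun x => g * x)%g).
apply: uniq_leq_size.
  by rewrite map_inj_uniq ?filter_uniq //; exact: mulgI.
by move=> _ /mapP[x + ->]; rewrite !mem_filter => /andP[/andP[-> ->]].
Qed.

(** A point that leaves [F] under [g * h] either leaves under [h] or is brought by [h] to a point of
    [F] that leaves under [g]. *)
Lemma movedM g h F : uniq F -> (moved (g * h)%g F <= moved g F + moved h F)%N.
Proof.
move=> uF; rewrite addnC /moved.
have := count_translate h (fun x => (g * x)%g \notin F) uF.
rewrite -(leq_add2l (moved h F)); apply: leq_trans.
rewrite /moved -count_predUI; apply: leq_trans (leq_addr _ _).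
by apply: sub_count => x /=; rewrite -mulgA => ->; rewrite andbT orNb.
Qed.

Lemma moved_sg a F : uniq F -> (moved (sg a) F <= size (bdry F))%N.
Proof.
move=> uF; rewrite /moved -size_filter -(size_map (fun x => sg a * x)%g).
apply: uniq_leq_size.
  by rewrite map_inj_uniq ?filter_uniq //; exact: mulgI.
move=> _ /mapP[x + ->]; rewrite !mem_filter => /andP[-> xF] /=.
by apply/nbhP; exists a, x.
Qed.

Lemma moved_wval w F : uniq F ->
  (moved (wval sg w) F <= size w * size (bdry F))%N.
Proof.
move=> uF; elim: w => [|a w IHw] /=.
  rewrite /moved (eq_in_count (a2 := pred0)) ?count_pred0 // => x xF.
  by rewrite mul1g xF.
rewrite mulSn; apply: leq_trans (movedM _ _ uF) _.
by rewrite leq_add // moved_sg.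
Qed.

(** Double counting: for a fixed [x], distinct [g] give distinct points [g * x] of [F]. *)
Lemma sum_translates F (T : seq G) : uniq F -> uniq T ->
  (\sum_(g <- T) count (fun x => (g * x)%g \in F) F <= size F * size F)%N.
Proof.
move=> uF uT; under eq_bigr do rewrite -sum1_count big_mkcond.
rewrite exchange_big /= -[X in (_ <= X * _)%N]sum1_size big_distrl /=.
apply: leq_sum => x _; rewrite mul1n -big_mkcond sum1_count.
rewrite -size_filter -(size_map (fun g => g * x)%g).
apply: uniq_leq_size.
  by rewrite map_inj_uniq ?filter_uniq //; exact: mulIg.
by move=> _ /mapP[g + ->]; rewrite mem_filter => /andP[].
Qed.

Hypothesis sg_onto : forall g, exists w, wval sg w = g.
Hypothesis infG : infinite_set [set: G].
Hypothesis torsion : forall g : G, exists2 n, (0 < n)%N & (g ^+ n = 1)%g.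

Lemma isoperimetry C : exists n, forall F, uniq F -> (n <= size F)%N ->
  (C <= size (bdry F))%N.
Proof.
case: C => [|C]; first by exists 0%N.
(* The size bound gives [8 * D <= r], whereas the averaging would give [r.+1 * r.+2 <= 2 * size T <=
   4 * size F < 8 * D * r.+1]. *)
set D := C.+1; exists (16 * D * D)%N => F uF large; rewrite leqNgt; apply/negP => small.
pose r := (size F %/ (2 * D))%N.
have [T [uT Tlarge] TP] := ball_growth sg_onto infG torsion r.
have overlap g : g \in T -> (size F <= 2 * count (fun x => (g * x)%g \in F) F)%N.
  move=> /TP[w [_ wr <-]]; have := moved_wval w uF.
  have : (count (fun x => (wval sg w * x)%g \in F) F + moved (wval sg w) F = size F)%N.
    exact: count_predC.
  move=> e le.
  have h1 : (size w * size (bdry F) <= r * D)%N by apply: leq_mul => //; exact: ltnW.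
  have h2 : (r * (2 * D) <= size F)%N by exact: leq_divM.
  lia.
have sums : (size T * size F <= 2 * (size F * size F))%N.
  apply: leq_trans (leq_mul (leqnn 2) (sum_translates uF uT)).
  rewrite -sum1_size big_distrl big_distrr /= big_seq [X in (_ <= X)%N]big_seq.
  by apply: leq_sum => g /overlap; rewrite mul1n.
have F0 : (0 < size F)%N by apply: leq_trans large; rewrite !muln_gt0.
have T2 : (size T <= 2 * size F)%N by rewrite -(leq_pmul2r F0) -mulnA.
have rlt : (size F < r.+1 * (2 * D))%N by exact: ltn_ceil.
have r8 : (8 * D <= r)%N.
  by rewrite leq_divRL //; apply: leq_trans large; lia.
nia.
Qed.

Lemma bdry_gt0 F : F != [::] -> (0 < size (bdry F))%N.
Proof.
move=> F0; rewrite lt0n size_eq0; apply/negP => /eqP b0; apply: infG.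
case: F F0 b0 => // x F _; set F' := x :: F => b0.
have closed w : (wval sg w * x)%g \in F'.
  elim: w => [|a w IHw] /=; first by rewrite mul1g inE eqxx.
  apply: contraT => nF; have : (sg a * (wval sg w * x))%g \in bdry F'.
    by rewrite mem_filter mulgA nF; apply/nbhP; exists a, (wval sg w * x)%g; rewrite mulgA.
  by rewrite b0.
apply: (@sub_finite_set _ _ [set` F']); last exact: finite_seq.
move=> g _ /=; have [w wg] := sg_onto (g * x^-1)%g.
by have := closed w; rewrite wg mulgKV.
Qed.

End Isoperimetry.

(** * Hall's theorem *)

Section Hall.
Variables I T : finType.
Implicit Types (N : I -> {set T}) (X : {set I}).

Definition neighbours N X : {set T} := (\bigcup_(i in X) N i)%SET.

Definition hall_condition N := forall X, (#|X| <= #|neighbours N X|)%N.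

Lemma neighboursU N X1 X2 :
  neighbours N (X1 :|: X2)%SET = (neighbours N X1 :|: neighbours N X2)%SET.
Proof. exact: finset.bigcup_setU. Qed.

Lemma neighbours_sub N X1 X2 : X1 \subset X2 ->
  neighbours N X1 \subset neighbours N X2.
Proof.
move=> sX; apply/finset.bigcupsP => i iX; apply: finset.bigcup_sup.
exact: (fintype.subsetP sX).
Qed.

Definition remove N (i : I) (y : T) : I -> {set T} :=
  fun j => if j == i then (N i :\ y)%SET else N j.

Lemma neighbours_remove N i y X : i \notin X ->
  neighbours (remove N i y) X = neighbours N X.
Proof.
move=> iX; apply: eq_bigr => j jX; rewrite /remove.
by case: eqP => // ji; move: iX; rewrite -ji jX.
Qed.

Lemma hall_remove_violation N i y : hall_condition N ->
  ~ hall_condition (remove N i y) ->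
  exists2 A : {set I}, i \notin A &
    (#|neighbours N A :|: (N i :\ y)| <= #|A|)%N.
Proof.
move=> hN /existsNP[X /negP]; rewrite -ltnNge => ltX.
have iX : i \in X.
  apply: contraLR ltX => iX; rewrite -leqNgt neighbours_remove //; exact: hN.
exists (X :\ i)%SET; first by rewrite !inE eqxx.
move: ltX; rewrite (cardsD1 i X) iX add1n ltnS -{1}(finset.setD1K iX).
rewrite neighboursU (@neighbours_remove N i y (X :\ i)%SET) ?inE ?eqxx // finset.setUC.
by rewrite {2}/neighbours finset.big_set1 /remove eqxx.
Qed.

(* Rado: a family satisfying Hall's condition in which some set has two elements
   satisfies it again after removing a suitable one of the two. *)
Theorem hall N : hall_condition N ->
  exists2 f : I -> T, injective f & forall i, f i \in N i.
Proof.
have [n] := ubnP (\sum_i #|N i|); elim: n N => // n IHn N; rewrite ltnS => leN hN.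
have N1 i : (0 < #|N i|)%N.
  by have := hN [set i]%SET; rewrite cards1 /neighbours finset.big_set1.
case: (boolP [exists i, (1 < #|N i|)%N]) => [/existsP[i /card_gt1P[y [z [yN zN yz]]]]|].
  have shrink t : t \in N i -> hall_condition (remove N i t) ->
      exists2 f : I -> T, injective f & forall j, f j \in N j.
    move=> tN hr; have [|f f_inj fN] := IHn (remove N i t) _ hr.
      apply: leq_trans leN; rewrite [ltnRHS](bigD1 i) //= (bigD1 i) //=.
      rewrite {1}/remove eqxx (cardsD1 t (N i)) tN add1n addSn ltnS leq_add2l.
      by apply: leq_sum => j /negPf ji; rewrite /remove ji.
    exists f => // j; have := fN j; rewrite /remove; case: eqP => // ->.
    by rewrite inE => /andP[].
  have [hy|/(hall_remove_violation hN)[A iA cA]] := pselect (hall_condition (remove N i y)).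
    exact: shrink hy.
  have [hz|/(hall_remove_violation hN)[B iB cB]] := pselect (hall_condition (remove N i z)).
    exact: shrink hz.
  exfalso; set P := (_ :|: _)%SET in cA; set Q := (_ :|: _)%SET in cB.
  (* As [y] and [z] differ, [P :|: Q] contains all of [N i]. Hall's condition for [i |: (A :|: B)]
     and for [A :&: B] then makes the sizes of [P] and [Q] add up to more than those of [A] and
     [B]. *)
  have PU : (#|A :|: B|.+1 <= #|P :|: Q|)%N.
    have <- : #|i |: (A :|: B)|%SET = #|A :|: B|.+1%SET.
      by rewrite cardsU1 inE negb_or iA iB.
    apply: leq_trans (hN _) _; apply: subset_leq_card.
    rewrite !neighboursU {1}/neighbours finset.big_set1.
    apply/fintype.subsetP => t; rewrite !inE.
    move=> /or3P[tN|->|->]; rewrite ?orbT // tN !andbT.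
    by case: eqVneq => [->|]; rewrite ?orbT // yz !orbT.
  have PI : (#|A :&: B| <= #|P :&: Q|)%N.
    apply: leq_trans (hN _) _; apply: subset_leq_card.
    rewrite finset.subsetI; apply/andP; split.
      apply: fintype.subset_trans (finset.subsetUl _ _).
      exact/neighbours_sub/finset.subsetIl.
    apply: fintype.subset_trans (finset.subsetUl _ _).
    exact/neighbours_sub/finset.subsetIr.
  have := cardsUI P Q; have := cardsUI A B; lia.
rewrite negb_exists => /forallP N2.
have /choice[f fN] i : exists y, N i = [set y]%SET.
  by apply/cards1P; rewrite eqn_leq N1 andbT leqNgt N2.
exists f => [i j fij|i]; last by rewrite fN inE.
apply/eqP; apply: contraT => ij; have := hN [set i; j]%SET.
rewrite cards2 ij neighboursU /neighbours !finset.big_set1 !fN fij.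
by rewrite finset.setUid cards1.
Qed.

End Hall.

(** * Disjoint rays *)

Section TorsionRays.
Variables (G : groupType) (m : nat) (sg : 'I_m -> G).
Implicit Types (F : seq G) (g : G).
Hypothesis sg_onto : forall g, exists w, wval sg w = g.
Hypothesis infG : infinite_set [set: G].
Hypothesis torsion : forall g : G, exists2 n, (0 < n)%N & (g ^+ n = 1)%g.
Hypothesis sg1 : exists a, sg a = 1%g.

Fixpoint reach n : seq G :=
  if n is k.+1
  then [seq ((sg c.1)^-1 * sg c.2 * g)%g | c <- enum {: 'I_m * 'I_m}, g <- reach k]
  else [:: 1%g].

Lemma reachS n a b g : g \in reach n -> ((sg a)^-1 * sg b * g)%g \in reach n.+1.
Proof.
move=> gn; apply/allpairsP; exists ((a, b), g); split=> //=.
by rewrite mem_enum.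
Qed.

Lemma reach_mono n k : (n <= k)%N -> {subset reach n <= reach k}.
Proof.
elim: k => [|k IHk]; first by rewrite leqn0 => /eqP->.
rewrite leq_eqVlt => /orP[/eqP->//|/IHk nk] g /nk gk.
by have [a _] := sg1; have := reachS a a gk; rewrite mulVg mul1g.
Qed.

Lemma reach1 n : 1%g \in reach n.
Proof. by apply: (reach_mono (leq0n n)); rewrite inE. Qed.

(** Connectedness of the graph on [F] that joins points with a common neighbour; [reach] collects
    the displacements along its paths. *)
Definition connected F := forall P : pred G, has P F -> has (predC P) F ->
  exists y z a b, [/\ y \in F, z \in F, P y, ~~ P z & (sg a * y = sg b * z)%g].

(** The part of [F] within [n] steps of [x] gains a point with each step until it is all of [F]. *)
Lemma connected_reach F x y : connected F -> x \in F -> y \in F ->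
  (y * x^-1)%g \in reach (size F).
Proof.
move=> conF xF yF; pose P n := fun y => (y * x^-1)%g \in reach n.
have grow n : all (P n) F \/ (n < count (P n) F)%N.
  elim: n => [|n [al|IHn]].
  - by right; rewrite -has_count; apply/hasP; exists x; rewrite // /P mulgV reach1.
  - left; apply/allP => z /(allP al); exact/reach_mono.
  have [|notall] := boolP (all (P n) F).
    by move=> al; left; apply/allP => z /(allP al); exact/reach_mono.
  right; rewrite -has_predC in notall.
  have [|y1 [z [a [b [_ zF Py nPz e]]]]] := conF (P n) _ notall.
    by apply/hasP; exists x => //; rewrite /P mulgV reach1.
  have Pz : P n.+1 z.
    have -> : z = ((sg b)^-1 * sg a * y1)%g by rewrite -mulgA e mulKg.
    by rewrite /P -mulgA; exact: reachS.
  apply: leq_trans (_ : (count (P n) F).+1 <= _)%N; first by [].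
  have -> : count (P n.+1) F = (count (P n) F + count (predD (P n.+1) (P n)) F)%N.
    rewrite -count_predUI [X in (_ + X)%N](eq_count (a2 := pred0)) ?count_pred0 ?addn0.
      apply: eq_count => u /=; case: (boolP (P n u)) => //=.
      by rewrite /P; exact/reach_mono.
    by move=> u /=; case: (P n u).
  by rewrite -addn1 leq_add2l -has_count; apply/hasP; exists z; rewrite //= nPz.
have [/allP/(_ y yF)//|] := grow (size F).
by rewrite ltnNge count_size.
Qed.

Lemma nbh_uniq F : uniq (nbh sg F).
Proof. exact: undup_uniq. Qed.

Lemma sub_nbh F : {subset F <= nbh sg F}.
Proof.
by move=> x xF; have [a a1] := sg1; apply/nbhP; exists a, x; rewrite a1 mul1g.
Qed.

Lemma size_nbh F : uniq F -> size (nbh sg F) = (size F + size (bdry sg F))%N.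
Proof.
move=> uF; rewrite -(count_predC (mem F) (nbh sg F)) -!size_filter; congr (_ + _)%N.
apply: perm_size; apply: uniq_perm => //; first by rewrite filter_uniq ?nbh_uniq.
move=> x; rewrite mem_filter /=; case: (boolP (x \in F)) => //= xF.
exact: sub_nbh.
Qed.

Variable nn : nat -> nat.
Hypothesis nnP : forall C F, uniq F -> (nn C <= size F)%N ->
  (C <= size (bdry sg F))%N.

Variable a : nat -> G.
Hypothesis a_sparse : forall i j b c g, (i < j)%N -> g \in reach (nn j.+1) ->
  a j <> (sg b * g * (sg c)^-1 * a i)%g.

Definition start : pred G := fun y => `[< exists i, a i = y >].

Lemma sparse_inj : injective a.
Proof.
have lt_neq i j : (i < j)%N -> a i <> a j.
  move=> ij e; have [c c1] := sg1; apply: (a_sparse (b := c) (c := c) ij (reach1 _)).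
  by rewrite c1 mulg1 invg1 !mul1g.
by move=> i j e; have [/lt_neq|/lt_neq|] := ltngtP i j => //; rewrite e.
Qed.

(* A connected set meeting two points of a sparse set is so large that its
   boundary makes up for the points lost. *)
Lemma nbh_start F : uniq F -> (size F <= count (predC start) (nbh sg F))%N.
Proof.
have [n] := ubnP (size F); elim: n F => // n IHn F; rewrite ltnS => Fn uF.
have cnt : (count start (nbh sg F) + count (predC start) (nbh sg F) =
    size F + size (bdry sg F))%N by rewrite count_predC size_nbh.
have [conF|/existsNP[P]] := pselect (connected F); last first.
  (* A disconnected set splits into two parts with disjoint neighbourhoods, and the inequality is
     additive over such parts. *)
  move=> /not_implyP[hP /not_implyP[hnP none]].
  pose F1 := seq.filter P F; pose F2 := seq.filter (predC P) F.
  have e : perm_eq (nbh sg F) (nbh sg F1 ++ nbh sg F2).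
    apply: uniq_perm; first exact: nbh_uniq.
      rewrite cat_uniq !nbh_uniq andbT /=; apply/hasPn => u /nbhP[b [z []]].
      rewrite mem_filter => /andP[nPz zF] uz; apply/negP => /nbhP[c [y []]].
      rewrite mem_filter => /andP[Py yF] uy; apply: none.
      by exists y, z, c, b; split=> //; rewrite -uz.
    move=> u; rewrite mem_cat; apply/nbhP/orP => [[b [x [xF ->]]]|].
      have [Px|nPx] := boolP (P x); [left|right]; apply/nbhP; exists b, x;
        by rewrite mem_filter /= ?Px ?nPx.
    by move=> [] /nbhP[b [x []]]; rewrite mem_filter => /andP[_ xF] ->; exists b, x.
  have sF := count_predC P F.
  move: hP hnP; rewrite !has_count => hP hnP.
  rewrite (permP e) count_cat -sF leq_add //.
    by rewrite -size_filter IHn ?filter_uniq // size_filter; lia.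
  by rewrite -size_filter IHn ?filter_uniq // size_filter; lia.
suff : (count start (nbh sg F) <= size (bdry sg F))%N by lia.
rewrite -size_filter; set J := seq.filter _ _.
have [->//|J0] := eqVneq J [::].
have uJ : uniq J by rewrite filter_uniq ?nbh_uniq.
have JP y : y \in J -> exists2 i, y = a i & y \in nbh sg F.
  by rewrite mem_filter => /andP[/asboolP[i <-] ?]; exists i.
have exJ : exists i, a i \in J.
  case E : J J0 => [//|y J'] _.
  by have [i yi _] := JP y ltac:(by rewrite E inE eqxx); exists i; rewrite -yi inE eqxx.
have [idx idxP] : exists idx : G -> nat, forall i, idx (a i) = i.
  have /choice[idx idxP] (y : G) : exists i, start y -> a i = y.
    have [[i iy]|ny] := pselect (exists i, a i = y); first by exists i.
    by exists 0%N => /asboolP.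
  by exists idx => i; apply: sparse_inj; apply: idxP; apply/asboolP; exists i.
have bdJ i : a i \in J -> (i <= \max_(y <- J) idx y)%N.
  by move=> aJ; rewrite -[leqLHS]idxP; exact: leq_bigmax_seq.
(* At most [j.+1] starting points are neighbours of [F]. A large [F] has that many boundary points.
   In a small one, [a_sparse] leaves [a j] as the only starting point nearby, and a nonempty
   boundary suffices. *)
case: (ex_maxnP exJ bdJ) => j aj jmax.
have [large|small] := leqP (nn j.+1) (size F).
  apply: leq_trans (nnP uF large); rewrite -[leqRHS](size_iota 0) -(size_map a).
  apply: uniq_leq_size => // y yJ; have [i yi _] := JP y yJ; apply/mapP.
  by exists i => //; rewrite mem_iota /= ltnS jmax // -yi.
have F0 : F != [::].
  apply: contraTneq aj => F0; rewrite mem_filter F0.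
  by apply/negP => /andP[_ /nbhP[b [x []]]].
apply: leq_trans (bdry_gt0 sg_onto infG F0).
rewrite -[1%N]/(size [:: a j]); apply: uniq_leq_size => // y yJ.
have [i yi /nbhP[c [u [uF' yu]]]] := JP y yJ; rewrite inE yi; apply/eqP; congr a.
apply/eqP; have : (i <= j)%N by rewrite jmax // -yi.
rewrite leq_eqVlt => /orP[//|ij]; exfalso.
have [_ _ /nbhP[b [v [vF av]]]] := JP _ aj.
apply: (a_sparse (b := b) (c := c) ij (g := (v * u^-1)%g)).
  by apply: (reach_mono (ltnW small)); exact: connected_reach.
by rewrite -yi yu av !mulgA mulgKV mulgKV.
Qed.

Lemma finite_matching F : uniq F -> exists p : G -> 'I_m,
  {in F &, injective (fun x => sg (p x) * x)%g} /\
  forall x, x \in F -> ~~ start (sg (p x) * x)%g.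
Proof.
move=> uF.
pose N (x : seq_sub F) := [set y : seq_sub (nbh sg F) |
  ~~ start (ssval y) && [exists b, ssval y == (sg b * ssval x)%g]]%SET.
have hN : hall_condition N.
  move=> X; pose F' := [seq ssval x | x <- enum X].
  have uF' : uniq F' by rewrite map_inj_uniq ?enum_uniq //; exact: val_inj.
  rewrite cardE -(size_map (@ssval _ F)); apply: leq_trans (nbh_start uF') _.
  rewrite -size_filter cardE -[leqRHS](size_map (@ssval _ _)).
  apply: uniq_leq_size; first by rewrite filter_uniq ?nbh_uniq.
  move=> y; rewrite mem_filter => /andP[ny /nbhP[b [_ [/mapP[x xX ->] yx]]]].
  have yN : y \in nbh sg F by apply/nbhP; exists b, (ssval x); split=> //; exact: valP.
  apply/mapP; exists (SeqSub yN) => //; rewrite mem_enum; apply/finset.bigcupP.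
  exists x; first by rewrite mem_enum in xX.
  rewrite inE; apply/andP; split; first exact: ny.
  by apply/existsP; exists b; rewrite /= yx.
have [f f_inj fN] := hall hN.
have [b0 _] := sg1.
have /choice[p pP] (x : G) : exists b, forall xF : x \in F,
    ssval (f (SeqSub xF)) = (sg b * x)%g.
  have [xF|nxF] := pselect (x \in F); last by exists b0.
  have := fN (SeqSub xF); rewrite inE => /andP[_ /existsP[b /eqP e]].
  by exists b => xF'; rewrite (bool_irrelevance xF' xF).
exists p; split=> [x y xF yF|x xF].
  by rewrite -(pP x xF) -(pP y yF) => /val_inj/f_inj[].
by rewrite -(pP x xF); have := fN (SeqSub xF); rewrite inE => /andP[].
Qed.

(** Compactness of the space of all [p]: each defect involves at most two points, so if every [p]
    had one, finitely many defects would be unavoidable, against [finite_matching]. *)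
Lemma infinite_matching : exists p : G -> 'I_m,
  injective (fun x => sg (p x) * x)%g /\ forall x, ~~ start (sg (p x) * x)%g.
Proof.
apply: contrapT => none.
pose bad (hh : G * G) (p : full_shift G 'I_m) := start (sg (p hh.1) * hh.1)%g \/
  hh.1 <> hh.2 /\ (sg (p hh.1) * hh.1 = sg (p hh.2) * hh.2)%g.
have [hh|p _|s sP] := @compact_finite_subcover _ _ (G * G)%type
    (fun hh => [set p | bad hh p]) (@full_shift_compact G 'I_m).
- rewrite openE => p badp.
  apply: (filterS _ (filterI (nbhs_full_shift p hh.1) (nbhs_full_shift p hh.2))).
  by move=> q [/= q1 q2]; rewrite /bad q1 q2.
- apply: contrapT => nbad; apply: none; exists p; split=> [x y e|x].
    by apply: contrapT => xy; apply: nbad; exists (x, y); right.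
  by apply/negP => st; apply: nbad; exists (x, x); left.
have [p [p_inj pst]] := finite_matching (undup_uniq (map fst s ++ map snd s)).
have [[x y] xys] := sP p I.
have xF : x \in undup (map fst s ++ map snd s).
  by rewrite mem_undup mem_cat; apply/orP; left; apply/mapP; exists (x, y).
have yF : y \in undup (map fst s ++ map snd s).
  by rewrite mem_undup mem_cat; apply/orP; right; apply/mapP; exists (x, y).
case=> /=; first by apply/negP; exact: pst.
by move=> [xy /(p_inj x y xF yF)].
Qed.

End TorsionRays.

(** * Ray systems in groups that are not virtually cyclic *)

Lemma generated_subgroup_zpow (G : groupType) (g : G) :
  generated_subgroup [set g] = range (zpow g).
Proof.
apply/seteqP; split; first exact: generated_zpow.
move=> _ [k _ <-] H [Hg gH]; have {}gH : g \in H by apply/mem_set/gH.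
have HX n : (g ^+ n)%g \in H.
  elim: n => [|n IHn]; first by rewrite expg0; case: Hg.
  by rewrite expgS; exact: (group_closedM Hg).
case: k => n /=; first exact: set_mem.
by apply/set_mem/(group_closedV Hg).
Qed.

Lemma infinite_not_virtually_cyclic (G : groupType) :
  ~ virtually_cyclic G -> infinite_set [set: G].
Proof.
move=> nvc fin; apply: nvc; exists 1%g.
exact: finite_image.
Qed.

(** The map phi sends [h] to [sg (p h) * h]. Starting points outside its image, with injectivity,
    make the forward orbits of the [a i] disjoint and free of cycles. *)
Definition ray_system (G : groupType) m (sg : 'I_m -> G) (p : G -> 'I_m)
    (a : nat -> G) :=
  [/\ injective (fun h => sg (p h) * h)%g, injective a &
      forall i h, (sg (p h) * h)%g <> a i].

Lemma infinite_order_rays (G : groupType) (g : G) :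
  ~ virtually_cyclic G -> (forall n, (0 < n)%N -> (g ^+ n)%g <> 1%g) ->
  exists m (sg : 'I_m -> G) p a, ray_system sg p a.
Proof.
move=> nvc g_inf.
have [|a aP] := @dependent_sequence G
    (fun l x => forall y k, y \in l -> x <> (zpow g k * y)%g).
  move=> l; apply: contrapT => none; apply: nvc; exists g.
  rewrite /finite_index generated_subgroup_zpow.
  pose coset (x : G) := [set (x * h)%g | h in range (zpow g)].
  apply: (@sub_finite_set _ _ ((fun y => coset (y^-1)%g) @` [set` l]));
    last by apply: finite_image; exact: finite_seq.
  (* The index counts left cosets, while left multiplication by [g] preserves right cosets;
     inversion exchanges the two. *)
  move=> _ [x _ <-]; have [y [k [yl xy]]] : exists y k, y \in l /\ (x^-1 = zpow g k * y)%g.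
    apply: contrapT => nyk; apply: none; exists (x^-1)%g => y k yl xy.
    by apply: nyk; exists y, k.
  exists y => //; rewrite /coset; have -> : x = (y^-1 * zpow g (- k))%g.
    apply: (can_inj (@invgK G)); rewrite xy invgM invgK; congr (_ * _)%g.
    by apply: (@mulgI _ (zpow g (- k))); rewrite -zpowD addNr mulgV.
  apply/seteqP; split=> [_ [_ [j _ <-] <-]|_ [_ [j _ <-] <-]].
    exists (zpow g (k + j)); first by exists (k + j).
    by rewrite -mulgA -zpowD addrA addNr add0r.
  exists (zpow g (- k + j)); first by exists (- k + j).
  by rewrite zpowD mulgA.
have a_coset i j k : a i = (zpow g k * a j)%g -> i = j.
  have lt_neq i' j' k' : (i' < j')%N -> a j' <> (zpow g k' * a i')%g.
    by move=> ij; apply: aP; apply/mapP; exists i'; rewrite // mem_iota.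
  move=> e; have [ij|ji|//] := ltngtP i j; last by case: (lt_neq _ _ _ ji e).
  case: (lt_neq _ _ (- k) ij); rewrite e mulgA -zpowD addNr.
  by rewrite /= expg0 mul1g.
(* Multiplying by [g] only on these half-cosets and fixing all else keeps the map injective and
   leaves [a i] without preimage. *)
pose on_ray h := exists i (n : nat), h = (g ^+ n * a i)%g.
pose sg (b : 'I_2) : G := if b == 0 then 1%g else g.
pose p h : 'I_2 := if `[< on_ray h >] then 1 else 0.
have phiE h : (sg (p h) * h)%g = if `[< on_ray h >] then (g * h)%g else h.
  by rewrite /p /sg; case: `[< _ >]; rewrite //= mul1g.
have on_raySE h : on_ray h -> on_ray (g * h)%g.
  by move=> [i [n ->]]; exists i, n.+1; rewrite expgS mulgA.
exists 2%N, sg, p, a; split.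
- move=> h h' /=; rewrite !phiE; case: asboolP => oh; case: asboolP => oh' //.
  + exact: mulgI.
  + by move=> e; case: oh'; rewrite -e; exact: on_raySE.
  + by move=> e; case: oh; rewrite e; exact: on_raySE.
- by move=> i j e; apply: (a_coset _ _ 0); rewrite /= expg0 mul1g.
move=> i h; rewrite phiE; case: asboolP => [[j [n ->]]|nh e]; last first.
  by apply: nh; exists i, 0%N; rewrite e expg0 mul1g.
rewrite mulgA -expgS => e; have ij : i = j by exact: (a_coset _ _ n.+1%:Z).
by apply: (g_inf n.+1) => //; apply: (@mulIg _ (a i)); rewrite mul1g -[RHS]e ij.
Qed.

Lemma finitely_generated_words (G : groupType) : finitely_generated G ->
  exists m (sg : 'I_m -> G), (exists b, sg b = 1%g) /\
    forall g, exists w, wval sg w = g.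
Proof.
move=> [S /finite_seqP[l ->] gen].
(* Words only multiply, hence the inverses; the unit puts every set inside its own neighbourhood. *)
pose l' := 1%g :: l ++ [seq (x^-1)%g | x <- l].
pose sg (b : 'I_(size l')) := nth 1%g l' b.
have sgP x : x \in l' -> exists b, sg b = x.
  move=> xl; have xi : (index x l' < size l')%N by rewrite index_mem.
  by exists (Ordinal xi); rewrite /sg /= nth_index.
have sgV b : exists c, sg c = ((sg b)^-1)%g.
  apply: sgP; have : sg b \in l' by apply: mem_nth.
  rewrite !inE !mem_cat => /orP[/eqP->|/orP[bl|/mapP[x xl ->]]].
  - by rewrite invg1 eqxx.
  - by rewrite [X in _ || (_ || X)]map_f ?orbT.
  - by rewrite invgK xl orbT.
have wvalV w : exists u, wval sg u = ((wval sg w)^-1)%g.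
  elim: w => [|b w [u uw]] /=; first by exists [::]; rewrite invg1.
  have [c cb] := sgV b; exists (u ++ [:: c]).
  by rewrite wval_cat uw /= cb mulg1 invgM.
exists (size l'), sg; split; first by apply: sgP; rewrite inE eqxx.
move=> g; have : generated_subgroup [set` l] g by rewrite gen.
move=> /(_ [set x | exists w, wval sg w = x]); apply; split.
  split=> [|x y /set_mem[u ux] /set_mem[v vy]]; apply/mem_set; first by exists [::].
  by have [w wv] := wvalV v; exists (u ++ w); rewrite wval_cat ux wv vy.
move=> x /= xl; have [|b bx] := sgP x; first by rewrite inE mem_cat xl orbT.
by exists [:: b]; rewrite /= mulg1.
Qed.

Lemma torsion_rays (G : groupType) : finitely_generated G ->
  ~ virtually_cyclic G ->
  (forall g : G, exists2 n, (0 < n)%N & (g ^+ n = 1)%g) ->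
  exists m (sg : 'I_m -> G) p a, ray_system sg p a.
Proof.
move=> /finitely_generated_words[m [sg [sg1 sg_onto]]].
move=> /infinite_not_virtually_cyclic infG torsion.
have /choice[nn nnP] := isoperimetry sg_onto infG torsion.
have [|a aP] := @dependent_sequence G (fun l' x => forall y b c g, y \in l' ->
    g \in reach sg (nn (size l').+1) -> x <> (sg b * g * (sg c)^-1 * y)%g).
  move=> l'; apply: contrapT => none; apply: infG.
  pose T := ('I_m * 'I_m)%type.
  apply: (@sub_finite_set _ _ [set` [seq (sg q.1.1 * q.1.2 * (sg q.2.1)^-1 * q.2.2)%g |
     q <- [seq (bg, cy) | bg <- [seq (b, g) | b <- enum 'I_m, g <- reach sg (nn (size l').+1)],
       cy <- [seq (c, y) | c <- enum 'I_m, y <- l']]]]);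
    last exact: finite_seq.
  move=> x _; apply: contrapT => nx; apply: none; exists x => y b c g yl gr xe.
  apply: nx; apply/mapP; exists ((b, g), (c, y)) => //.
  by apply: allpairs_f; apply: allpairs_f => //; rewrite mem_enum.
have a_sparse i j b c g : (i < j)%N -> g \in reach sg (nn j.+1) ->
    a j <> (sg b * g * (sg c)^-1 * a i)%g.
  move=> ij gr; apply: aP; first by apply/mapP; exists i; rewrite // mem_iota.
  by rewrite size_map size_iota.
have [p [p_inj pst]] := infinite_matching sg_onto infG sg1 nnP a_sparse.
exists m, sg, p, a; split=> //.
  exact: (sparse_inj sg1 a_sparse).
by move=> i h e; have /negP := pst h; apply; apply/asboolP; exists i.
Qed.

Lemma disjoint_rays (G : groupType) : finitely_generated G ->
  ~ virtually_cyclic G ->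
  exists m (sg : 'I_m -> G) p a, ray_system sg p a.
Proof.
move=> fgG nvc.
have [[g gP]|tor] := pselect (exists g : G, forall n, (0 < n)%N -> (g ^+ n)%g <> 1%g).
  exact: infinite_order_rays gP.
apply: torsion_rays => // g; apply: contrapT => ng; apply: tor; exists g => n n0 gn.
by apply: ng; exists n.
Qed.

(** * Binary expansions modulo one *)

Section DistanceToIntegers.
Variable R : realType.
Implicit Types x y : R.

(** Distance to the nearest integer, that is, the norm on R/Z. *)
Definition nrm x : R :=
  let f := x - (Num.floor x)%:~R in Num.min f (1 - f).

Lemma nrm_int x : exists k : int, nrm x = `|x - k%:~R|.
Proof.
have /andP[fx xf] := floor_itv x; rewrite /nrm; set f := _ - _.
have f0 : 0 <= f by rewrite /f; lra.
have f1 : f < 1 by move: xf; rewrite intrD /f; lra.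
rewrite /Num.min; case: ifP => _.
  by exists (Num.floor x); rewrite ger0_norm.
exists (Num.floor x + 1); rewrite intrD ler0_norm; first by rewrite /f; lra.
by move: f1; rewrite /f; lra.
Qed.

Lemma nrm_le x (k : int) : nrm x <= `|x - k%:~R|.
Proof.
have /andP[fx xf] := floor_itv x; rewrite intrD in xf.
rewrite /nrm; set f := _ - _.
have [kf|kf] := leP k (Num.floor x).
  have kf' : k%:~R <= (Num.floor x)%:~R :> R by rewrite ler_int.
  rewrite ger0_norm; first by rewrite ge_min /f; apply/orP; left; lra.
  by lra.
have kf' : (Num.floor x)%:~R + 1 <= k%:~R :> R by rewrite -intrD1 ler_int; lia.
rewrite ler0_norm; first by rewrite ge_min /f; apply/orP; right; lra.
by lra.
Qed.

Lemma nrm_ge0 x : 0 <= nrm x.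
Proof. by have [k ->] := nrm_int x. Qed.

Lemma nrm_le_norm x : nrm x <= `|x|.
Proof. by have := nrm_le x 0; rewrite subr0. Qed.

Lemma nrm_le1 x : nrm x <= 1.
Proof.
have /andP[fx xf] := floor_itv x; rewrite intrD in xf.
by rewrite /nrm ge_min; apply/orP; left; lra.
Qed.

Lemma nrm0 : nrm 0 = 0.
Proof.
by apply/le_anti; rewrite nrm_ge0 andbT; have := nrm_le_norm 0; rewrite normr0.
Qed.

Lemma nrm_addz x (k : int) : nrm (x + k%:~R) = nrm x.
Proof.
have le y (j : int) : nrm (y + j%:~R) <= nrm y.
  have [i ->] := nrm_int y; apply: le_trans (nrm_le _ (i + j)) _.
  by rewrite intrD (_ : _ - _ = y - i%:~R) //; ring.
apply/le_anti; rewrite le /=.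
by have := le (x + k%:~R) (- k); rewrite intrN addrK.
Qed.

Lemma nrmN x : nrm (- x) = nrm x.
Proof.
have le y : nrm (- y) <= nrm y.
  have [i ->] := nrm_int y; apply: le_trans (nrm_le _ (- i)) _.
  by rewrite intrN -normrN opprB opprK addrC.
by apply/le_anti; rewrite le -[in leLHS](opprK x) le.
Qed.

Lemma nrmD x y : nrm (x + y) <= nrm x + nrm y.
Proof.
have [i ->] := nrm_int x; have [j ->] := nrm_int y.
apply: le_trans (nrm_le _ (i + j)) _; apply: le_trans (ler_normD _ _).
by rewrite intrD (_ : _ - _ = x - i%:~R + (y - j%:~R)) //; ring.
Qed.

(** Below 1/4 doubling does not wrap around: every integer other than [2 * i] is more than 1/2 away
    from [2 * x]. *)
Lemma nrm_double x : nrm x < 1 / 4 -> 2 * nrm x <= nrm (2 * x).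
Proof.
have [i ->] := nrm_int x => lt; have [j ->] := nrm_int (2 * x).
have [->|ne] := eqVneq j (2 * i).
  have -> : 2 * x - (2 * i)%:~R = 2 * (x - i%:~R) by rewrite intrM; ring.
  by rewrite normrM ger0_norm.
have : 1 <= `|j%:~R - (2 * i)%:~R| :> R.
  by rewrite -intrB -intr_norm ler1z; lia.
rewrite intrM => h.
have : `|j%:~R - 2%:~R * i%:~R| <= `|2 * x - j%:~R| + 2 * `|x - i%:~R| :> R.
  rewrite -[in X in _ <= _ + X](@ger0_norm _ 2) // -normrM -[X in _ <= X + _]normrN.
  apply: le_trans (ler_normD _ _).
  by rewrite (_ : - _ + _ = j%:~R - 2%:~R * i%:~R) //; ring.
lra.
Qed.

End DistanceToIntegers.

Section BinaryValue.
Variable R : realType.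
Implicit Types b : nat -> bool.

Definition bsum b n : R := \sum_(i < n) (b i)%:R * 2 ^- i.+1.

Definition bval b : R := sup (range (bsum b)).

Lemma eq_approx (x y : R) : (forall n, `|x - y| <= 2 ^- n) -> x = y.
Proof.
move=> h; apply/eqP; rewrite -subr_eq0 -normr_le0 leNgt; apply/negP => xy.
by have [n] := exp2V_lt xy; rewrite ltNge h.
Qed.

Lemma bsumSl b n : bsum b n.+1 = ((b 0%N)%:R + bsum (b \o succn) n) / 2.
Proof.
rewrite /bsum big_ord_recl /= expr1 mulrDl; congr (_ + _).
rewrite mulr_suml; apply: eq_bigr => i _; rewrite /= -mulrA; congr (_ * _).
by rewrite -invfM -exprSr.
Qed.

Lemma bsum_ge0 b n : 0 <= bsum b n.
Proof. by apply: sumr_ge0 => i _; rewrite mulr_ge0 // invr_ge0 exprn_ge0. Qed.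

Lemma bsum_le b n k : bsum b k <= bsum b n + 2 ^- n.
Proof.
have half (x : R) m : x / 2 ^+ m.+1 = x / 2 ^+ m / 2.
  by rewrite exprSr invfM mulrA.
have le1 c : ((c : bool)%:R : R) <= 1 by rewrite lern1 leq_b1.
elim: n k b => [|n IHn] k b.
  elim: k b => [|k IHk] b; first by rewrite /bsum !big_ord0 expr0 invr1 add0r ler01.
  rewrite bsumSl [bsum b 0]/bsum big_ord0 add0r expr0 invr1.
  have := IHk (b \o succn); rewrite [bsum _ 0]/bsum big_ord0 add0r expr0 invr1.
  by have := le1 (b 0%N); lra.
case: k => [|k].
  rewrite [X in X <= _]/bsum big_ord0.
  by rewrite addr_ge0 ?bsum_ge0 // invr_ge0 exprn_ge0.
rewrite !bsumSl -[2 ^- n.+1]mul1r half.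
have := IHn k (b \o succn); lra.
Qed.

Lemma bval_ge b n : bsum b n <= bval b.
Proof.
apply: ub_le_sup; last by exists n.
by exists (bsum b 0 + 2 ^- 0) => _ [k _ <-]; exact: bsum_le.
Qed.

Lemma bval_le b n : bval b <= bsum b n + 2 ^- n.
Proof.
apply: ge_sup; first by exists (bsum b 0), 0%N.
by move=> _ [k _ <-]; exact: bsum_le.
Qed.

Lemma bval_unique b x :
  (forall n, bsum b n <= x <= bsum b n + 2 ^- n) -> bval b = x.
Proof.
move=> h; apply: eq_approx => n; have /andP[h1 h2] := h n.
have := bval_ge b n; have := bval_le b n.
by rewrite ler_norml; lra.
Qed.

Lemma bvalS b : 2 * bval b = (b 0%N)%:R + bval (b \o succn).
Proof.
have -> : bval b = ((b 0%N)%:R + bval (b \o succn)) / 2; last by lra.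
apply: bval_unique => -[|n].
  have := bval_ge (b \o succn) 0; have := bval_le (b \o succn) 0.
  rewrite /bsum !big_ord0 expr0 invr1; case: (b 0%N) => /=; lra.
rewrite bsumSl exprSr invfM.
have := bval_ge (b \o succn) n; have := bval_le (b \o succn) n; lra.
Qed.

Lemma bval_near b b' n : bsum b n = bsum b' n -> `|bval b - bval b'| <= 2 ^- n.
Proof.
move=> e; have := bval_ge b n; have := bval_le b n.
have := bval_ge b' n; have := bval_le b' n.
by rewrite ler_norml e; lra.
Qed.

Lemma bval_false : bval (fun=> false) = 0.
Proof.
apply: bval_unique => n; rewrite /bsum big1 => [|i _]; last by rewrite mul0r.
by rewrite lexx add0r invr_ge0 exprn_ge0.
Qed.

(** The value at 1 is 1 and not 0, so that the closed interval is invariant and 1 has the expansion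
    with all digits 1. *)
Definition double_mod1 (t : R) : R := 2 * t - (2^-1 <= t)%R%:R.

Definition digit (t : R) (n : nat) : bool := 2^-1 <= iter n double_mod1 t.

Lemma double_mod1_itv t : 0 <= t <= 1 -> 0 <= double_mod1 t <= 1.
Proof. by rewrite /double_mod1; case: (leP 2^-1 t) => /=; lra. Qed.

Lemma iter_double_itv t n : 0 <= t <= 1 -> 0 <= iter n double_mod1 t <= 1.
Proof. by move=> t01; elim: n => //= n; exact: double_mod1_itv. Qed.

Lemma digit_iter t n k : digit (iter n double_mod1 t) k = digit t (k + n).
Proof. by rewrite /digit iterD. Qed.

Lemma bval_digit t : 0 <= t <= 1 -> bval (digit t) = t.
Proof.
move=> t01; apply: bval_unique => n; elim: n t t01 => [|n IHn] t t01.
  by rewrite /bsum big_ord0 expr0 invr1; lra.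
have e : digit t \o succn = digit (double_mod1 t).
  by apply/funext => k; rewrite /= -[double_mod1 t]/(iter 1 double_mod1 t) digit_iter addn1.
have := IHn _ (double_mod1_itv t01); rewrite -e bsumSl exprSr invfM /double_mod1.
rewrite /digit /=; lra.
Qed.

Lemma nrm_iter_double s t n :
  nrm (iter n double_mod1 s - iter n double_mod1 t) = nrm (2 ^+ n * (s - t)).
Proof.
have int u : exists k : int, iter n double_mod1 u = 2 ^+ n * u + k%:~R.
  elim: n => [|n [k IHn]] /=; first by exists 0; rewrite expr0 mul1r addr0.
  exists (2 * k - (2^-1 <= iter n double_mod1 u)%R%:Z).
  by rewrite {1}/double_mod1 IHn intrB intrM exprS; ring.
have [j ->] := int s; have [k ->] := int t.
rewrite -(nrm_addz (2 ^+ n * (s - t)) (j - k)); congr nrm.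
by rewrite intrB; ring.
Qed.

End BinaryValue.

(** * Metrization by countably many pseudometrics *)

Section SupMetric.
Variables (R : realType) (X : topologicalType) (D : nat -> X -> X -> R).
Hypothesis D_ge0 : forall n x y, 0 <= D n x y.
Hypothesis D_le1 : forall n x y, D n x y <= 1.
Hypothesis Dxx : forall n x, D n x x = 0.
Hypothesis D_sym : forall n x y, D n x y = D n y x.
Hypothesis D_triangle : forall n y x z, D n x z <= D n x y + D n y z.
Hypothesis D_sep : forall x y, (forall n, D n x y = 0) -> x = y.
Hypothesis D_nbhs : forall n x e, 0 < e -> nbhs x [set y | D n x y < e].

Definition sup_metric x y : R := sup (range (fun n => 2 ^- n * D n x y)).

Local Lemma pow_gt0 n : 0 < 2 ^- n :> R.
Proof. by rewrite invr_gt0 exprn_gt0. Qed.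

Local Lemma pow_le1 n : 2 ^- n <= 1 :> R.
Proof. by rewrite invf_le1 ?exprn_gt0 // exprn_ege1 // ler1n. Qed.

Lemma sup_metric_ge n x y : 2 ^- n * D n x y <= sup_metric x y.
Proof.
apply: ub_le_sup; last by exists n.
by exists 1 => _ [k _ <-]; apply: mulr_ile1; rewrite ?pow_le1 ?D_le1 // ltW ?pow_gt0.
Qed.

Lemma sup_metric_le x y e :
  (forall n, 2 ^- n * D n x y <= e) -> sup_metric x y <= e.
Proof.
move=> h; apply: ge_sup; first by exists (2 ^- 0 * D 0%N x y), 0%N.
by move=> _ [n _ <-].
Qed.

Lemma sup_metric_sym x y : sup_metric x y = sup_metric y x.
Proof. by congr sup; apply/seteqP; split=> _ [n _ <-]; exists n; rewrite // D_sym. Qed.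

Lemma sup_metric_triangle y x z :
  sup_metric x z <= sup_metric x y + sup_metric y z.
Proof.
apply: sup_metric_le => n; apply: le_trans (lerD (sup_metric_ge n _ _) (sup_metric_ge n _ _)).
by rewrite -mulrDr ler_pM2l ?pow_gt0.
Qed.

(** The weights make all but finitely many [D n] small. Stated along a map [f], this serves both the
    neighbourhoods in [X] and the continuity of maps into [X]. *)
Lemma sup_metric_near (T : topologicalType) (f : T -> X) (t : T) e : 0 < e ->
  (forall n r, 0 < r -> nbhs t [set s | D n (f t) (f s) < r]) ->
  nbhs t [set s | sup_metric (f t) (f s) < e].
Proof.
move=> e0 fP; have e2 : 0 < e / 2 by lra.
have [N Ne] := exp2V_lt e2.
have : nbhs t [set s | forall n : 'I_N, D n (f t) (f s) < e / 2].
  by apply: filter_forall => n; exact: fP.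
apply: filterS => s /= sP; apply: (@le_lt_trans _ _ (e / 2)); last by lra.
apply: sup_metric_le => n; have [nN|Nn] := ltnP n N.
  apply: le_trans (ltW (sP (Ordinal nN))).
  by rewrite -[leRHS]mul1r ler_wpM2r ?pow_le1.
apply: le_trans (ltW Ne); rewrite -[leRHS]mulr1.
apply: ler_pM => //; first by rewrite ltW ?pow_gt0.
by rewrite lef_pV2 ?posrE ?exprn_gt0 // ler_eXn2l ?ltr1n.
Qed.

Hypothesis cX : compact [set: X].

(** [D_nbhs] makes metric balls neighbourhoods. Conversely, outside an open neighbourhood of [x] the
    distance to [x] is bounded below by compactness. *)
Lemma sup_metric_compatible : compatible_metric sup_metric.
Proof.
have refl x : sup_metric x x = 0.
  apply/le_anti; rewrite sup_metric_le => [|n]; last by rewrite Dxx mulr0.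
  by have := sup_metric_ge 0 x x; rewrite Dxx mulr0.
have ball_nbhs x e : 0 < e -> nbhs x [set y | sup_metric x y < e].
  by move=> e0; apply: (@sup_metric_near X id) => // n r; exact: D_nbhs.
split=> [//|x y xy|||x].
- apply: D_sep => n; apply/le_anti; rewrite D_ge0 andbT.
  by rewrite -(pmulr_rle0 _ (pow_gt0 n)) -xy sup_metric_ge.
- exact: sup_metric_sym.
- exact: sup_metric_triangle.
apply/seteqP; split=> A; last first.
  by move=> [e /= e0 eA]; apply: filterS eA _; exact: ball_nbhs.
rewrite nbhsE => -[U [oU Ux] UA].
have cU : compact (~` U) by apply: (subclosed_compact (open_closedC oU) cX).
have [n|y nUy|s sP] := @compact_finite_subcover X _ nat
    (fun n => [set y | 2 ^- n < sup_metric x y]) cU.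
- rewrite openE => y /= xy.
  have r0 : 0 < sup_metric x y - 2 ^- n by lra.
  apply: filterS (ball_nbhs y _ r0) => z /= yz.
  by have := sup_metric_triangle z x y; rewrite (sup_metric_sym z y); lra.
- apply: exp2V_lt; rewrite lt_neqAle -[X in _ && (X <= _)](refl x).
  apply/andP; split.
    apply/eqP => /esym xy; apply: nUy; suff <- : x = y by [].
    apply: D_sep => n; apply/le_anti; rewrite D_ge0 andbT.
    by rewrite -(pmulr_rle0 _ (pow_gt0 n)) -xy sup_metric_ge.
  apply: sup_metric_le => n; rewrite Dxx mulr0.
  by apply: le_trans (sup_metric_ge n x y); rewrite mulr_ge0 // ltW ?pow_gt0.
exists (2 ^- (\max_(n <- s) n)); first exact: pow_gt0.
move=> y /= xy; apply: UA; apply: contrapT => /sP[n ns]; apply/negP; rewrite -leNgt.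
apply: le_trans (ltW xy) _.
by rewrite lef_pV2 ?posrE ?exprn_gt0 // ler_eXn2l ?ltr1n //; exact: leq_bigmax_seq.
Qed.

Lemma sup_metric_continuous (T : topologicalType) (f : T -> X) :
  (forall t n r, 0 < r -> nbhs t [set s | D n (f t) (f s) < r]) -> continuous f.
Proof.
move=> fP t A /(cmetric_nbhsP sup_metric_compatible)[e e0 eA].
have := sup_metric_near e0 (fP t); apply: filterS => s; exact: eA.
Qed.

End SupMetric.

(** * The shift of pointers and binary digits *)

Section PointerShift.
Variables (R : realType) (G : groupType) (m : nat) (sg : 'I_m -> G).

Local Notation alphabet := ('I_m * bool)%type.
Local Notation config := (full_shift G alphabet).
Implicit Types (y z : config) (g h : G).

(* The first component of a symbol is an arrow, the second a binary digit. *)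
Definition next y h : G := (sg (y h).1 * h)%g.

Definition digits_along y h (n : nat) : bool := (y (iter n (next y) h)).2.

Definition angle y h : R := bval R (digits_along y h).

(** Arrows multiply on the left and the shift acts on the right, so following arrows commutes with
    the action. *)
Lemma orbit_shift g y h n :
  iter n (next y) (h * g)%g = (iter n (next (gact g y)) h * g)%g.
Proof. by elim: n => //= n ->; rewrite /next mulgA. Qed.

Lemma angle_shift g y h : angle (gact g y) h = angle y (h * g)%g.
Proof.
by congr bval; apply/funext => n; rewrite /digits_along orbit_shift.
Qed.

Lemma angle_next y h : 2 * angle y h = (y h).2%:R + angle y (next y h).
Proof.
rewrite /angle bvalS; congr (_ + bval R _); apply/funext => n.
by rewrite /= /digits_along iterSr.
Qed.

Lemma digits_near y h n : nbhs y [set z | z h = y h /\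
  bsum R (digits_along z h) n = bsum R (digits_along y h) n].
Proof.
(* One coordinate more than the [n] digits, so that the symbol at [h] agrees even for [n = 0]. *)
have near : nbhs y [set z | forall i : 'I_n.+1,
    z (iter i (next y) h) = y (iter i (next y) h)].
  apply: (@filter_forall _ _ (fun (i : 'I_n.+1) (z : config) =>
    z (iter i (next y) h) = y (iter i (next y) h)) (nbhs y) _) => i.
  exact: nbhs_full_shift.
apply: filterS near => z /= zP.
have orb i : (i <= n)%N -> iter i (next z) h = iter i (next y) h.
  elim: i => [//|i IHi] iN; rewrite /= IHi ?(ltnW iN) //.
  by rewrite /next (zP (Ordinal (leqW iN))).
split; first exact: (zP ord0).
apply: eq_bigr => i _; have iN : (i < n.+1)%N by rewrite ltnW // ltnS ltn_ord.
by rewrite /digits_along orb 1?ltnW // (zP (Ordinal iN)).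
Qed.

(** The value 1 for different arrows bounds [nrm], which keeps the triangle inequality. *)
Definition gap h y z : R :=
  if (y h).1 == (z h).1 then nrm (angle y h - angle z h) else 1.

Lemma gap_ge0 h y z : 0 <= gap h y z.
Proof. by rewrite /gap; case: ifP => _; [exact: nrm_ge0|exact: ler01]. Qed.

Lemma gap_le1 h y z : gap h y z <= 1.
Proof. by rewrite /gap; case: ifP => _; [exact: nrm_le1|]. Qed.

Lemma gapxx h y : gap h y y = 0.
Proof. by rewrite /gap eqxx subrr nrm0. Qed.

Lemma gap_sym h y z : gap h y z = gap h z y.
Proof. by rewrite /gap eq_sym; case: ifP => // _; rewrite -nrmN opprB. Qed.

Lemma gap_triangle h z y w : gap h y w <= gap h y z + gap h z w.
Proof.
have [yz|yz] := eqVneq (y h).1 (z h).1; last first.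
  by rewrite {2}/gap (negPf yz); have := gap_le1 h y w; have := gap_ge0 h z w; lra.
have [zw|zw] := eqVneq (z h).1 (w h).1; last first.
  by rewrite {3}/gap (negPf zw); have := gap_le1 h y w; have := gap_ge0 h y z; lra.
rewrite /gap yz zw !eqxx; apply: le_trans (nrmD _ _).
by rewrite subrKA.
Qed.

Lemma gap_shift g h y z : gap h (gact g y) (gact g z) = gap (h * g)%g y z.
Proof. by rewrite /gap !angle_shift. Qed.

Lemma gap_near h y e : 0 < e -> nbhs y [set z | gap h y z < e].
Proof.
move=> e0; have [n ne] := exp2V_lt e0.
apply: filterS (digits_near y h n) => z [/= zh zn].
rewrite /gap zh eqxx; apply: le_lt_trans (nrm_le_norm _) _.
by apply: le_lt_trans ne; apply: bval_near.
Qed.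

Local Notation pair_shift := (full_shift G (alphabet * alphabet)%type).

Definition left_config (z : pair_shift) : config := fun h => (z h).1.
Definition right_config (z : pair_shift) : config := fun h => (z h).2.

Definition same_angles : set pair_shift :=
  [set z | forall h, gap h (left_config z) (right_config z) = 0].

(* A bound 1/16 on the error of the truncation to four digits lets the
   truncated difference tell a gap of at least 1/4 from a vanishing one. *)
Definition forbidden : set pair_shift :=
  [set z | (z 1%g).1.1 <> (z 1%g).2.1 \/
    1 / 16 < nrm (bsum R (digits_along (left_config z) 1%g) 4 -
                  bsum R (digits_along (right_config z) 1%g) 4)].

Lemma left_config_continuous : continuous left_config.
Proof.
apply: full_shift_continuous => z h; apply: filterS (nbhs_full_shift z h).
by move=> w /= wz; rewrite /left_config wz.
Qed.

Lemma right_config_continuous : continuous right_config.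
Proof.
apply: full_shift_continuous => z h; apply: filterS (nbhs_full_shift z h).
by move=> w /= wz; rewrite /right_config wz.
Qed.

Lemma forbidden_clopen : clopen forbidden.
Proof.
pose agree (c : pair_shift -> config) (z w : pair_shift) := c w 1%g = c z 1%g /\
  bsum R (digits_along (c w) 1%g) 4 = bsum R (digits_along (c z) 1%g) 4.
have near (z : pair_shift) : nbhs z [set w | forbidden w <-> forbidden z].
  have n1 : nbhs z [set w | agree left_config z w] :=
    left_config_continuous (digits_near (left_config z) 1%g 4).
  have n2 : nbhs z [set w | agree right_config z w] :=
    right_config_continuous (digits_near (right_config z) 1%g 4).
  apply: filterS (filterI n1 n2) => w [/= [l1 l2] [r1 r2]].
  rewrite /left_config in l1; rewrite /right_config in r1.
  by rewrite /forbidden /= l1 r1 l2 r2.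
split; first by rewrite openE => z zC; apply: filterS (near z) => w /= ->.
rewrite -[X in closed X]setCK; apply: open_closedC.
by rewrite openE => z zC; apply: filterS (near z) => w /= wz /wz.
Qed.

(** As long as gaps stay below 1/4 they at least double along each common arrow, since the digits
    change [2 * angle] only by integers; but gaps never exceed 1. *)
Lemma gap_doubling y z h : (forall h, (y h).1 = (z h).1) ->
  0 < gap h y z -> exists h', 1 / 4 <= gap h' y z.
Proof.
move=> yz g0; apply: contrapT => small.
have nextE : next y = next z by apply/funext => u; rewrite /next yz.
have gapE u : gap u y z = nrm (angle y u - angle z u) by rewrite /gap yz eqxx.
have double u : 2 * gap u y z <= gap (next y u) y z.
  rewrite !gapE; apply: le_trans (nrm_double _) _.
    by rewrite -gapE ltNge; apply/negP => h'; apply: small; exists u.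
  rewrite mulrBr !angle_next nextE.
  rewrite -(nrm_addz (angle y (next z u) - _) ((y u).2%:Z - (z u).2%:Z)).
  rewrite intrB le_eqVlt; apply/orP; left; apply/eqP; congr nrm; ring.
have pow n : 2 ^+ n * gap h y z <= gap (iter n (next y) h) y z.
  elim: n => [|n IHn]; first by rewrite mul1r.
  by rewrite exprS -mulrA /=; apply: le_trans (double _); rewrite ler_pM2l.
have [n n_lt] := exp2V_lt g0.
have := pow n; have := gap_le1 (iter n (next y) h) y z.
move=> h1 h2; have := le_trans h2 h1; apply/negP; rewrite -ltNge.
by rewrite mulrC -ltr_pdivrMr ?exprn_gt0 // mul1r.
Qed.

(** Both truncations err downwards by at most [2 ^- 4], so the two errors do not add up in the
    difference. *)
Lemma gap_truncated y z : (y 1%g).1 = (z 1%g).1 ->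
  `|nrm (bsum R (digits_along y 1%g) 4 - bsum R (digits_along z 1%g) 4) -
    gap 1%g y z| <= 1 / 16.
Proof.
move=> yz; rewrite /gap yz eqxx.
set b := bsum _ _ _; set c := bsum _ _ _.
have e : `|(b - c) - (angle y 1%g - angle z 1%g)| <= 1 / 16.
  have := bval_ge R (digits_along y 1%g) 4; have := bval_le R (digits_along y 1%g) 4.
  have := bval_ge R (digits_along z 1%g) 4; have := bval_le R (digits_along z 1%g) 4.
  rewrite -/b -/c -/(angle y 1%g) -/(angle z 1%g) ler_norml.
  have -> : 2 ^- 4 = 1 / 16 :> R by rewrite -natrX mul1r.
  lra.
have := nrmD (b - c - (angle y 1%g - angle z 1%g)) (angle y 1%g - angle z 1%g).
have := nrmD (- (b - c - (angle y 1%g - angle z 1%g))) (b - c).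
rewrite nrmN subrK opprB subrK.
have := nrm_le_norm (b - c - (angle y 1%g - angle z 1%g)).
by rewrite ler_norml; lra.
Qed.

Lemma pair_gap_shift g h (z : pair_shift) :
  gap h (left_config (gact g z)) (right_config (gact g z)) =
  gap (h * g)%g (left_config z) (right_config z).
Proof. exact: (gap_shift g h (left_config z) (right_config z)). Qed.

Lemma same_anglesP (z : pair_shift) :
  same_angles z <-> forall g, ~ forbidden (gact g z).
Proof.
split=> [zZ g|zC h].
  have := zZ g; rewrite -[in gap g](mul1g g) -pair_gap_shift => g0.
  have h1 : (gact g z 1%g).1.1 = (gact g z 1%g).2.1.
    by apply: contrapT => /eqP/negPf ne; move/eqP: g0; rewrite /gap ne oner_eq0.
  have := @gap_truncated (left_config (gact g z)) (right_config (gact g z)) h1.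
  rewrite g0 subr0 => tr [//|].
  by apply/negP; rewrite -leNgt; apply: le_trans tr; rewrite ler_norm.
have actE u : gact u z 1%g = z u by rewrite -[LHS]/(z (1 * u)%g) mul1g.
have ptr u : (z u).1.1 = (z u).2.1.
  by apply: contrapT => ne; apply: (zC u); left; rewrite actE.
apply/le_anti; rewrite gap_ge0 andbT leNgt; apply/negP => /gap_doubling.
move=> /(_ ptr)[u]; rewrite -[u](mul1g u) -pair_gap_shift => large.
have h1 : (gact u z 1%g).1.1 = (gact u z 1%g).2.1 by rewrite actE ptr.
have := @gap_truncated (left_config (gact u z)) (right_config (gact u z)) h1.
by rewrite ler_norml => tr; apply: (zC u); right; move: tr large; lra.
Qed.

Lemma same_angles_SFT : is_SFT same_angles.
Proof.
split; last by exists forbidden; [exact: forbidden_clopen|exact: same_anglesP].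
split=> [|g z zZ h]; last by rewrite pair_gap_shift; exact: zZ.
have -> : same_angles = \bigcap_g ~` (gact g @^-1` forbidden).
  apply/seteqP; split=> z.
    by move=> /same_anglesP zC g _; exact: zC.
  by move=> zC; apply/same_anglesP => g; exact: zC.
apply: closed_bigI => g _; apply: open_closedC; apply: open_comp.
  by move=> z _; exact: gact_continuous.
exact: forbidden_clopen.1.
Qed.

Lemma setT_SFT : is_SFT [set: config].
Proof.
split; first by split; [exact: closedT|].
exists set0 => [|x]; last by split=> // _ g.
by split; [exact: open0|exact: closed0].
Qed.

Lemma same_angles_equiv : is_equivalence_on [set: config] same_angles.
Proof.
apply: And3 => [y|y z|z y w].
- by apply/asboolP => h; exact: gapxx.
- by apply: asbool_equiv_eq; split=> zZ h; have := zZ h; rewrite gap_sym.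
move=> /asboolP yz /asboolP zw; apply/asboolP => h.
apply/le_anti; rewrite gap_ge0 andbT; apply: le_trans (gap_triangle h (\val z) _ _) _.
by rewrite (yz h) (zw h) addr0.
Qed.

End PointerShift.

(** * A universal quotient *)

Lemma finitely_generated_enum (G : groupType) : finitely_generated G ->
  exists en : nat -> G, forall g, exists n, en n = g.
Proof.
move=> /finitely_generated_words[m [sg [_ onto]]].
exists (fun n => if unpickle n is Some w then wval sg w else 1%g) => g.
by have [w <-] := onto g; exists (pickle w); rewrite pickleK.
Qed.

(** Distances to the points of a countable dense set, cut off at 1/2 because the values become
    angles, and [0, 1/2] injects into R/Z. *)
Lemma separating_functions (R : realType) (K : topologicalType)
    (d : K -> K -> R) : compatible_metric d -> compact [set: K] ->
  exists t : nat -> K -> R, [/\ forall i k, 0 <= t i k <= 1 / 2,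
    forall i k k', `|t i k - t i k'| <= d k k' &
    forall k k', (forall i, t i k = t i k') -> k = k'].
Proof.
move=> dK cK.
have /choice[net netP] n : exists s : seq K, forall x, exists2 c, c \in s & d c x < 2 ^- n.
  by apply: (cmetric_totally_bounded dK cK); rewrite invr_gt0 exprn_gt0.
pose t (i : nat) (k : K) : R :=
  if unpickle i is Some (n, j) then
    if onth (net n) j is Some c then Num.min (d c k) (1 / 2) else 0
  else 0.
exists t; split=> [i k|i k k'|k k' tE].
- rewrite /t; case: unpickle => [[n j]|]; last lra.
  case: onth => [c|]; last lra.
  by have := cmetric_ge0 dK c k; rewrite /Num.min; case: ifP; lra.
- have d0 := cmetric_ge0 dK k k'.
  rewrite /t; case: unpickle => [[n j]|]; last by rewrite subrr normr0.
  case: onth => [c|]; last by rewrite subrr normr0.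
  have := cmetric_triangle dK k c k'; have := cmetric_triangle dK k' c k.
  rewrite (cmetric_sym dK k' k) ler_norml /Num.min.
  by do 2 case: ifP => /=; lra.
apply: contrapT => kk'; have d0 := cmetric_gt0 dK kk'.
(* A net point [c] this close to [k] is farther from [k'], and its distance to [k] is below the
   cutoff. *)
have e0 : 0 < Num.min (d k k' / 2) (1 / 2) by rewrite lt_min; apply/andP; split; lra.
have [n] := exp2V_lt e0; rewrite lt_min => /andP[n1 n2].
have [c cn ck] := netP n k.
have := tE (pickle (n, index c (net n))); rewrite /t pickleK.
rewrite (onthE (net n)) (nth_map c) ?index_mem // nth_index //.
have := cmetric_triangle dK c k k'; rewrite (cmetric_sym dK k c) /Num.min.
by do 2 case: ifP => /=; lra.
Qed.

Section UniversalQuotient.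
Variables (R : realType) (G : groupType) (m : nat) (sg : 'I_m -> G).
Variables (p : G -> 'I_m) (a : nat -> G) (en : nat -> G).
Hypothesis rays : ray_system sg p a.
Hypothesis en_onto : forall g, exists n, en n = g.

Local Notation config := (full_shift G ('I_m * bool)%type).

Definition universal_gspace : gspace G := subshift_quotient
  (setT_SFT G m).1 (same_angles_SFT R sg).1 (same_angles_equiv R sg).

Local Notation Q := universal_gspace.

Definition in_full (y : config) : [set: config] :=
  exist _ y (mem_set (I : [set: config] y)).

Definition class (y : config) : Q :=
  subshift_pi (setT_SFT G m).1 (same_angles_SFT R sg).1 (same_angles_equiv R sg)
    (in_full y).

Lemma classP y z : class y = class z <-> forall h, gap R sg h y z = 0.
Proof. by split=> [/subshift_piP //|yz]; apply/subshift_piP. Qed.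

Lemma class_surj (q : Q) : exists y, class y = q.
Proof.
have [[y yT] <-] := subshift_pi_surj q; exists y.
by congr subshift_pi; exact: val_inj.
Qed.

Lemma gap_class h y z w : class y = class z -> gap R sg h y w = gap R sg h z w.
Proof.
move=> /classP yz; apply/le_anti/andP; split.
  by have := gap_triangle R sg h z y w; rewrite yz add0r.
by have := gap_triangle R sg h y z w; rewrite (gap_sym R sg h z y) yz add0r.
Qed.

Lemma universal_compact : compact [set: Q].
Proof. exact: subshift_quotient_compact. Qed.

Lemma quot_section : exists sec : Q -> config, forall q, class (sec q) = q.
Proof. by have /choice[sec secP] := class_surj; exists sec. Qed.

Section Metric.
Variable sec : Q -> config.
Hypothesis secK : forall q, class (sec q) = q.

Definition quot_gap n (q r : Q) : R := gap R sg (en n) (sec q) (sec r).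

Lemma quot_gap_classr n q z :
  quot_gap n q (class z) = gap R sg (en n) (sec q) z.
Proof. by rewrite /quot_gap gap_sym (gap_class _ _ (secK _)) gap_sym. Qed.

Lemma quot_gap_class n y z :
  quot_gap n (class y) (class z) = gap R sg (en n) y z.
Proof. by rewrite quot_gap_classr (gap_class _ _ (secK _)). Qed.

Lemma quot_gap_sep q r : (forall n, quot_gap n q r = 0) -> q = r.
Proof.
move=> qr; rewrite -(secK q) -(secK r); apply/classP => h.
by have [n <-] := en_onto h; exact: qr.
Qed.

Lemma class_open (A : set Q) : open (class @^-1` A) -> open A.
Proof.
move=> oA.
have : open ((fun y : [set: config] => class (\val y)) @^-1` A).
  apply: (@open_comp _ _ (\val : [set: config] -> config)) oA.
  by move=> y _; exact: initial_continuous.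
move=> oA'; suff : open (subshift_pi (setT_SFT G m).1 (same_angles_SFT R sg).1
    (same_angles_equiv R sg) @^-1` A) by [].
move: oA'; congr open; apply/seteqP; split=> y /=;
  by rewrite /class (_ : in_full (\val y) = y) //; exact: val_inj.
Qed.

Lemma quot_gap_nbhs n q e : 0 < e -> nbhs q [set r | quot_gap n q r < e].
Proof.
move=> e0; apply: open_nbhs_nbhs; split; last by rewrite /= /quot_gap gapxx.
apply: class_open; rewrite openE => y /=; rewrite quot_gap_classr => qy.
have r0 : 0 < e - gap R sg (en n) (sec q) y by lra.
apply: filterS (gap_near sg (en n) y r0) => z /= yz.
have := gap_triangle R sg (en n) y (sec q) z.
rewrite quot_gap_classr; lra.
Qed.

Lemma universal_metric : compatible_metric (sup_metric quot_gap).
Proof.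
apply: sup_metric_compatible.
- by move=> *; exact: gap_ge0.
- by move=> *; exact: gap_le1.
- by move=> *; exact: gapxx.
- by move=> *; exact: gap_sym.
- by move=> *; exact: gap_triangle.
- exact: quot_gap_sep.
- exact: quot_gap_nbhs.
exact: universal_compact.
Qed.

(** Binary digits jump as a real number varies, so [ray_config] cannot be expected to be continuous
    into the product; the gaps, which see only angles, do vary continuously. *)
Lemma class_comp_continuous (K : topologicalType) (f : K -> config) :
  (forall k h r, 0 < r -> nbhs k [set k' | gap R sg h (f k) (f k') < r]) ->
  continuous (class \o f).
Proof.
move=> fP; apply: (sup_metric_continuous (D := quot_gap)) => [||||||||k n r r0].
- by move=> *; exact: gap_ge0.
- by move=> *; exact: gap_le1.
- by move=> *; exact: gapxx.
- by move=> *; exact: gap_sym.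
- by move=> *; exact: gap_triangle.
- exact: quot_gap_sep.
- exact: quot_gap_nbhs.
- exact: universal_compact.
apply: filterS (fP k (en n) r r0) => k' /=.
by rewrite quot_gap_class.
Qed.

End Metric.

Let phi h := (sg (p h) * h)%g.

Lemma ray_uniq i j n k : iter n phi (a i) = iter k phi (a j) -> i = j /\ n = k.
Proof.
have [phi_inj a_inj a_start] := rays.
have aux i' j' n' k' : (n' <= k')%N -> iter n' phi (a i') = iter k' phi (a j') ->
    i' = j' /\ n' = k'.
  elim: n' k' => [|n' IHn] [|k'] //=.
  - by move=> _ /a_inj.
  - by move=> _ /esym/a_start.
  by rewrite ltnS => le /phi_inj/(IHn _ le)[-> ->].
have [nk|/ltnW kn] := leqP n k; first exact: aux.
by move=> /esym/(aux _ _ _ _ kn)[-> ->].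
Qed.

(** Cancelling phi shows that orbits enter a ray only from within it. Hence points off the rays read
    zero digits only. *)
Lemma off_ray h n i k : iter n phi h = iter k phi (a i) ->
  exists j, h = iter j phi (a i).
Proof.
have [phi_inj a_inj a_start] := rays.
elim: n k => [|n IHn] [|k] /=.
- by exists 0%N.
- by exists k.+1.
- by move=> /a_start.
by move=> /phi_inj/IHn.
Qed.

(** * Embedding a compact metrizable space *)

Section Embedding.
Variables (K : topologicalType) (d : K -> K -> R).
Hypotheses (dK : compatible_metric d) (cK : compact [set: K]).
Variable t : nat -> K -> R.
Hypothesis t_itv : forall i k, 0 <= t i k <= 1 / 2.
Hypothesis t_lip : forall i k k', `|t i k - t i k'| <= d k k'.
Hypothesis t_sep : forall k k', (forall i, t i k = t i k') -> k = k'.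

Variable loc : G -> option (nat * nat).
Hypothesis locP : forall i n, loc (iter n phi (a i)) = Some (i, n).
Hypothesis locN : forall h i n, loc h = Some (i, n) -> h = iter n phi (a i).

Definition ray_config (k : K) : config := fun h =>
  (p h, if loc h is Some (i, n) then digit (t i k) n else false).

Lemma next_ray_config k : next sg (ray_config k) = phi.
Proof. by []. Qed.

Lemma angle_on_ray k i n :
  angle R sg (ray_config k) (iter n phi (a i)) = iter n (@double_mod1 R) (t i k).
Proof.
have t01 : 0 <= t i k <= 1 by have := t_itv i k; lra.
rewrite -[RHS](bval_digit (iter_double_itv n t01)); congr bval.
apply/funext => j; rewrite /digits_along next_ray_config -iterD digit_iter.
by rewrite /ray_config locP.
Qed.

Lemma angle_off_ray k h : loc h = None -> angle R sg (ray_config k) h = 0.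
Proof.
move=> nh; rewrite -[RHS](bval_false R); congr bval; apply/funext => n.
rewrite /digits_along next_ray_config /ray_config /=.
case E : (loc _) => [[i j]|//]; have [l hl] := off_ray (locN E).
by move: nh; rewrite hl locP.
Qed.

(** At the [n]-th point of ray [i] the angle is [2 ^+ n * t i k] modulo 1, a Lipschitz function of
    [k]; off the rays it is constantly 0. *)
Lemma gap_ray_config h : exists C, 0 < C /\
  forall k k', gap R sg h (ray_config k) (ray_config k') <= C * d k k'.
Proof.
case E : (loc h) => [[i n]|].
  exists (2 ^+ n); split=> [|k1 k2]; first by rewrite exprn_gt0.
  rewrite /gap eqxx (locN E) !angle_on_ray nrm_iter_double.
  apply: le_trans (nrm_le_norm _) _; rewrite normrM ger0_norm ?exprn_ge0 //.
  by rewrite ler_pM2l ?exprn_gt0.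
exists 1; split=> // k1 k2.
by rewrite /gap eqxx !angle_off_ray // subrr nrm0 mul1r (cmetric_ge0 dK).
Qed.

Lemma ray_config_continuous (sec : Q -> config) (secK : forall q, class (sec q) = q) :
  continuous (class \o ray_config).
Proof.
apply: (class_comp_continuous secK) => k h r r0.
have [C [C0 CP]] := gap_ray_config h.
apply/(cmetric_nbhsP dK); exists (r / C); first by rewrite divr_gt0.
by move=> k' kk' /=; apply: le_lt_trans (CP _ _) _; rewrite mulrC -ltr_pdivlMr.
Qed.

Lemma ray_config_inj : injective (class \o ray_config).
Proof.
move=> k k' /classP kk'; apply: t_sep => i.
have := kk' (a i); rewrite /gap eqxx -[a i]/(iter 0 phi (a i)) !angle_on_ray /=.
have [j ->] := nrm_int (t i k - t i k').
have := t_itv i k; have := t_itv i k'; move=> h1 h2 /eqP.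
rewrite normr_eq0 subr_eq0 => /eqP e.
(* Two values in [0, 1/2] that agree modulo 1 are equal. *)
have j1 : `|j%:~R| < 1 :> R by rewrite -e ltr_norml; lra.
have j0 : j = 0 by move: j1; rewrite -intr_norm ltrz1; lia.
by move: e; rewrite j0; lra.
Qed.

End Embedding.
End UniversalQuotient.

Lemma universal_contains_copy (R : realType) (G : groupType) m (sg : 'I_m -> G)
    p a (en : nat -> G) (K : topologicalType) :
  ray_system sg p a -> (forall g, exists n, en n = g) ->
  compact_metrizable R K -> contains_copy (universal_gspace R sg) K.
Proof.
move=> rays en_onto [cK [d dK]].
have [t [t_itv t_lip t_sep]] := separating_functions dK cK.
pose phi h := (sg (p h) * h)%g.
have /choice[loc locP] (h : G) : exists o : option (nat * nat),
    if o is Some (i, n) then h = iter n phi (a i)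
    else forall i n, h <> iter n phi (a i).
  have [[i [n hin]]|nh] := pselect (exists i n, h = iter n phi (a i)).
    by exists (Some (i, n)).
  by exists None => i n hin; apply: nh; exists i, n.
have locR i n : loc (iter n phi (a i)) = Some (i, n).
  have := locP (iter n phi (a i)); case: (loc _) => [[j k] e|/(_ i n)//].
  by have [-> ->] := ray_uniq rays e.
have locN h i n : loc h = Some (i, n) -> h = iter n phi (a i).
  by move=> e; have := locP h; rewrite e.
have [sec secK] := quot_section R sg.
have dQ := universal_metric en_onto secK.
exists (class R sg \o ray_config p t loc); apply: compact_embedding => //.
- exact: cmetric_hausdorff dQ.
- exact: (ray_config_continuous rays en_onto dK t_itv t_lip locR locN secK).
- exact: (ray_config_inj t_itv t_sep locR).
Qed.

Lemma universal_SFT_over_SFT (R : realType) (G : groupType) :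
  finitely_generated G -> ~ virtually_cyclic G ->
  exists X : dynsys R G, SFT_over_SFT X /\
    forall K : topologicalType, compact_metrizable R K -> contains_copy X K.
Proof.
move=> fgG nvc.
have [m [sg [p [a rays]]]] := disjoint_rays fgG nvc.
have [en en_onto] := finitely_generated_enum fgG.
have [sec secK] := quot_section R sg.
have cmQ : compact_metrizable R (universal_gspace R sg).
  split; first exact: universal_compact.
  by exists (sup_metric (quot_gap en sec)); exact: universal_metric.
exists (DynSys cmQ); split.
  exists ('I_m * bool)%type, setT, (same_angles R sg), (setT_SFT G m),
    (same_angles_SFT R sg), (same_angles_equiv R sg).
  by exists id, id; split=> // x; exact: cvg_id.
by move=> K; exact: (universal_contains_copy rays en_onto).
Qed.

Theorem theorem1p5 (R : realType) (G : groupType) (fgG : finitely_generated G) :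
  [<-> ~ virtually_cyclic G;
       exists X : dynsys R G, infinite_dimensional X /\ expansive X;
       exists X : dynsys R G, infinite_dimensional X /\ subshift_over_SFT X;
       exists X : dynsys R G, SFT_over_SFT X /\
         forall K : topologicalType, compact_metrizable R K ->
           contains_copy X K].
Proof.
have h34 : (exists X : dynsys R G, SFT_over_SFT X /\
      forall K : topologicalType, compact_metrizable R K -> contains_copy X K) ->
    exists X : dynsys R G, infinite_dimensional X /\ subshift_over_SFT X.
  move=> [X [[S [Y [Z [sftY [sftZ [eqvZ conjX]]]]]] univ]]; exists X; split.
    exact: universal_infinite_dimensional (dynsys_compact_metrizable X) univ.
  by exists S, Y, Z, sftY.1, sftZ, eqvZ.
have h23 : (exists X : dynsys R G, infinite_dimensional X /\ subshift_over_SFT X) ->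
    exists X : dynsys R G, infinite_dimensional X /\ expansive X.
  by move=> [X [infX quotX]]; exists X; split=> //; exact: subshift_over_SFT_expansive.
have h12 : (exists X : dynsys R G, infinite_dimensional X /\ expansive X) ->
    ~ virtually_cyclic G.
  move=> [X [infX expX]] vc.
  by have [n] := expansive_virtually_cyclic vc expX; exact: infX.
have h41 := @universal_SFT_over_SFT R G fgG.
tfae.
- by move=> /h41/h34/h23.
- by move=> /h12/h41/h34.
- by move=> /h23/h12/h41.
- by move=> /h34/h23/h12.
Qed.
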